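(* Let $\mathcal{A}$ be a unital $*$-algebra with two states $\varphi,\psi$ ($\psi$ tracial), and let $\mathbb{X}_1,\mathbb{X}_2,\dots\in\mathcal{A}$ be such that: (1) the sequence satisfies Kargin's Condition A with respect to $(\varphi|\psi)$; (2) for every $k\ge1$, $\sup_{j_1,\dots,j_k\ge1}|\varphi(\mathbb{X}_{j_1}\cdots\mathbb{X}_{j_k})|\le C_k<\infty$; (3) with $s_j^2:=\psi(\mathbb{X}_j^2)$ and $S_j^2:=\varphi(\mathbb{X}_j^2)$, we have $(s_1^2+\dots+s_n^2)/n\to s^2$ and $(S_1^2+\dots+S_n^2)/n\to S^2$; (4) $0<s,S<\infty$; (5) the $\psi$-moments of $\frac{1}{\sqrt{s_1^2+\dots+s_n^2}}\sum_{j=1}^n\mathbb{X}_j$ converge to the corresponding moments of a compactly supported probability measure $\nu$. Then the $\varphi$-moments of $\frac{1}{\sqrt{S_1^2+\dots+S_n^2}}\sum_{j=1}^n\mathbb{X}_j$ converge to the moments of the unique compactly supported probability measure $\mu$ whose Cauchy transform is $$G(z)=\int\frac{\mu(dx)}{z-x}=\frac{1}{z-g(z)},\qquad g(z)=\int\frac{S}{Sz-sx}\,\nu(dx).$$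
   Context: $\mathcal{A}$ is a unital $*$-algebra with two states (positive normalized linear functionals) $\varphi,\psi$, $\psi$ tracial. A sequence $\mathbb{X}_1,\mathbb{X}_2,\dots$ satisfies Kargin's Condition A with respect to $(\varphi|\psi)$ if: (i) for every $k\notin\{j_1,\dots,j_r\}$ (any $r\ge0$), $\varphi(\mathbb{X}_k\mathbb{X}_{j_1}\cdots\mathbb{X}_{j_r})=\varphi(\mathbb{X}_{j_1}\mathbb{X}_k\mathbb{X}_{j_2}\cdots\mathbb{X}_{j_r})=\dots=\varphi(\mathbb{X}_{j_1}\cdots\mathbb{X}_{j_r}\mathbb{X}_k)=0$ and $\psi(\mathbb{X}_k\mathbb{X}_{j_1}\cdots\mathbb{X}_{j_r})=0$ (in particular $\varphi(\mathbb{X}_j)=\psi(\mathbb{X}_j)=0$); (ii) for every $k\notin\{j_1,\dots,j_r\}$ and $0\le p\le r$, $$\varphi(\mathbb{X}_k\mathbb{X}_{j_1}\cdots\mathbb{X}_{j_p}\mathbb{X}_k\mathbb{X}_{j_{p+1}}\cdots\mathbb{X}_{j_r})=\varphi(\mathbb{X}_k^2)\,\psi(\mathbb{X}_{j_1}\cdots\mathbb{X}_{j_p})\,\varphi(\mathbb{X}_{j_{p+1}}\cdots\mathbb{X}_{j_r}),$$ with empty products equal to $1$. *)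

(* Defs.v *)
From HB Require Import structures.
From mathcomp Require Import all_boot all_order all_algebra.
From mathcomp Require Import all_classical all_reals all_analysis.
From mathcomp Require Import complex.
Set Implicit Arguments. Unset Strict Implicit. Unset Printing Implicit Defensive.
Import Order.TTheory GRing.Theory Num.Theory.
Local Open Scope ring_scope.
Local Open Scope complex_scope.

Section Defs.
Context {R : realType}.
Local Notation C := R[i].

Definition star_algebra (A : algType C) (star : A -> A) : Prop :=
  [/\ forall x y, star (x + y) = star x + star y,
      forall (c : C) x, star (c *: x) = c^* *: star x,
      forall x y, star (x * y) = star y * star x &
      forall x, star (star x) = x].

Definition is_state (A : algType C) (star : A -> A) (phi : A -> C) : Prop :=
  [/\ forall (c : C) x y, phi (c *: x + y) = c * phi x + phi y,
      phi 1 = 1 &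
      forall x, 0 <= phi (star x * x)].

Definition tracial (A : algType C) (psi : A -> C) : Prop :=
  forall x y, psi (x * y) = psi (y * x).

Definition wprod (A : algType C) (X : nat -> A) (w : seq nat) : A :=
  \prod_(j <- w) X j.

Definition kargin_conditionA (A : algType C) (phi psi : A -> C) (X : nat -> A) : Prop :=
  (forall (k : nat) (w : seq nat), k \notin w ->
     (forall p, (p <= size w)%N ->
        phi (wprod X (take p w) * X k * wprod X (drop p w)) = 0)
     /\ psi (X k * wprod X w) = 0) /\
  (forall (k : nat) (w : seq nat) (p : nat), k \notin w -> (p <= size w)%N ->
     phi (X k * wprod X (take p w) * X k * wprod X (drop p w)) =
     phi (X k ^+ 2) * psi (wprod X (take p w)) * phi (wprod X (drop p w))).

Definition cvgC (u : nat -> C) (l : C) : Prop :=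
  forall eps : R, 0 < eps -> exists N : nat, forall n, (N <= n)%N ->
    `|u n - l| < eps%:C.

Definition normalized_sum (A : algType C) (omega : A -> C) (X : nat -> A) (n : nat) : A :=
  (sqrtC (\sum_(j < n) omega (X j ^+ 2)))^-1 *: \sum_(j < n) X j.

Definition compactly_supported (mu : probability R R) : Prop :=
  exists M : R, mu [set x : R | M < `|x|]%classic = 0%E.

Definition moment (mu : probability R R) (m : nat) : R :=
  \int[mu]_x (x ^+ m).

Definition cintegral (mu : probability R R) (f : R -> C) : C :=
  Complex (\int[mu]_x complex.Re (f x)) (\int[mu]_x complex.Im (f x)).

Definition cauchy_transform (mu : probability R R) (z : C) : C :=
  cintegral mu (fun x => (z - x%:C)^-1).

Definition g_transform (s S : R) (nu : probability R R) (z : C) : C :=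
  cintegral nu (fun x => S%:C / (S%:C * z - (s * x)%:C)).

End Defs.

(* Main.v *)
(** Expand [phi ((X_0 + ... + X_(n-1))^m)] over words. A word with a letter
    occurring once contributes nothing, and the words with fewer than [m / 2]
    distinct letters are negligible after division by [n^(m/2)]. Matching the
    first letter with its partner, Condition A (ii) therefore gives in the limit
    [b_(r+2) = S^2 * sum_(p <= r) a_p b_(r-p)], where [a_p] and [b_p] are the
    limits of the moments of [psi] and [phi] normalized by [sqrt n]. The odd
    limits vanish, so the branch of the complex square root in the normalization
    is irrelevant and no selfadjointness is needed.

    With [t = s / S], the limits [m_r] satisfy
    [m_(r+2) = sum_p t^p nu_p m_(r-p)], i.e. they are the moments at [(1, 0)] of
    the operator [T (c, f) = (int f dnu, c + t x f)] on [R + L^2(nu)]. Writing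
    [D] for the divided difference integrated against [m], the functional
    [L_m] satisfies [L_m (p q) = L_m p L_m q + L_nu (Dp Dq)]. This yields
    [L_m ((K + X)^i (K - X)^j) >= 0] for [K = 1 + norm of t x], and the Hausdorff
    moment problem provides [mu]: the quantile functions of the Bernstein
    measures converge along an ultrafilter, and Riemann sums of monotone
    functions converge uniformly, so moments pass to the limit.

    The equation for the Cauchy transform is the divided-difference identity for
    the partial sums of the geometric series of [1 / (z - x)] about a point far
    below the real axis. Conversely the Cauchy transform on the upper half-plane
    determines the moments (let [z] tend to infinity), hence the measure. *)
Require Import Defs.
From HB Require Import structures.
From mathcomp Require Import all_boot all_order all_algebra.
From mathcomp Require Import all_classical all_reals all_analysis.
From mathcomp Require Import complex measurable_realfun ring lra zify.
Import Order.TTheory GRing.Theory Num.Theory.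
Import numFieldNormedType.Exports.
Set Implicit Arguments. Unset Strict Implicit. Unset Printing Implicit Defensive.
Local Open Scope classical_set_scope.
Local Open Scope ring_scope.
Local Open Scope complex_scope.

(** * Moment functionals and divided differences *)

Section MomentFunctional.
Variable F : comNzRingType.
Implicit Types (a m : nat -> F) (p q : {poly F}).

(** Integration against a measure with moments [a], available before any such measure is known to
    exist. *)
Definition polyfun a p : F := \sum_(i < size p) p`_i * a i.

Lemma polyfun_wide a p n : (size p <= n)%N ->
  polyfun a p = \sum_(i < n) p`_i * a i.
Proof.
move=> pn; rewrite /polyfun (big_ord_widen n (fun i => p`_i * a i) pn).
rewrite big_mkcond /=; apply: eq_bigr => i _.
by case: ltnP => // si; rewrite nth_default ?mul0r.
Qed.

Lemma polyfun_is_linear a : linear_for *%R (polyfun a).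
Proof.
move=> c p q; set n := maxn (size (c *: p + q)) (maxn (size p) (size q)).
rewrite !(@polyfun_wide _ _ n) ?leq_max ?leqnn ?orbT //.
rewrite mulr_sumr -big_split /=; apply: eq_bigr => i _.
by rewrite coefD coefZ mulrDl mulrA.
Qed.

HB.instance Definition _ a :=
  GRing.isLinear.Build F {poly F} F *%R (polyfun a) (polyfun_is_linear a).

Lemma polyfunXn a n : polyfun a 'X^n = a n.
Proof.
rewrite (@polyfun_wide _ _ n.+1) ?size_polyXn// big_ord_recr /=.
rewrite coefXn eqxx mul1r big1 ?add0r// => i _.
by rewrite coefXn ltn_eqF ?mul0r.
Qed.

Lemma polyfunC a c : a 0%N = 1 -> polyfun a c%:P = c.
Proof.
move=> a0; rewrite -[c%:P]mulr1 mul_polyC linearZ /= -(expr0 'X) polyfunXn.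
by rewrite a0 mulr1.
Qed.

(* The divided difference [(p(x) - p(y)) / (x - y)] integrated in [x] against
   the functional with moments [m], as a polynomial in [y]. *)
Definition divdiff m p : {poly F} :=
  \sum_(n < size p) p`_n *: \poly_(i < n) m (n.-1 - i)%N.

Lemma divdiff_wide m p n : (size p <= n)%N ->
  divdiff m p = \sum_(j < n) p`_j *: \poly_(i < j) m (j.-1 - i)%N.
Proof.
move=> pn; rewrite /divdiff.
rewrite (big_ord_widen n (fun j => p`_j *: \poly_(i < j) m (j.-1 - i)%N) pn).
rewrite big_mkcond /=; apply: eq_bigr => i _.
by case: ltnP => // si; rewrite nth_default ?scale0r.
Qed.

Lemma divdiff_is_linear m : linear (divdiff m).
Proof.
move=> c p q; set n := maxn (size (c *: p + q)) (maxn (size p) (size q)).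
rewrite !(@divdiff_wide _ _ n) ?leq_max ?leqnn ?orbT //.
rewrite scaler_sumr -big_split /=; apply: eq_bigr => i _.
by rewrite coefD coefZ scalerDl scalerA.
Qed.

HB.instance Definition _ m :=
  GRing.isLinear.Build F {poly F} {poly F} *:%R (divdiff m) (divdiff_is_linear m).

Lemma divdiffXn m n : divdiff m 'X^n = \poly_(i < n) m (n.-1 - i)%N.
Proof.
rewrite (@divdiff_wide _ _ n.+1) ?size_polyXn// big_ord_recr /=.
rewrite coefXn eqxx scale1r big1 ?add0r// => i _.
by rewrite coefXn ltn_eqF ?scale0r.
Qed.

Lemma divdiffC m c : divdiff m c%:P = 0.
Proof.
rewrite -[c%:P]mulr1 mul_polyC linearZ /= -(expr0 'X) divdiffXn.
by apply/polyP => i; rewrite coefZ coef_poly coef0 mulr0.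
Qed.

(** Integrates in [x] the identity [(x p(x) - y p(y)) / (x - y) = p(x) + y (p(x) - p(y)) / (x -
    y)]. *)
Lemma divdiffMX m p : divdiff m (p * 'X) = (polyfun m p)%:P + divdiff m p * 'X.
Proof.
rewrite -[p]coefK poly_def mulr_suml !linear_sum /= rmorph_sum /= mulr_suml.
rewrite -big_split; apply: eq_bigr => i _.
rewrite -scalerAl !linearZ /= -scalerAl polyCM mul_polyC -scalerDr polyfunXn.
congr (_ *: _).
rewrite -exprSr !divdiffXn; apply/polyP => j.
rewrite coefD coefC coefMX !coef_poly /=.
case: j => [|j] /=; first by rewrite subn0 addr0.
by rewrite add0r ltnS; case: ltnP => // ji; congr m; lia.
Qed.

Variables a m : nat -> F.
Hypothesis a0 : a 0%N = 1.
Hypothesis m0 : m 0%N = 1.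
Hypothesis m1 : m 1%N = 0.
Hypothesis mSS : forall r, m r.+2 = \sum_(p < r.+1) a p * m (r - p)%N.

Lemma polyfun_poly b n (E : nat -> F) :
  polyfun b (\poly_(i < n) E i) = \sum_(i < n) E i * b i.
Proof.
rewrite (@polyfun_wide _ _ n) ?size_poly//.
by apply: eq_bigr => i _; rewrite coef_poly ltn_ord.
Qed.

(** By linearity only [p = 'X^n] matters: [m1] settles [n = 0] and the recursion the rest. For
    generating series the recursion reads [M(x) = 1 + x^2 A(x) M(x)], the formal version of
    [G = 1 / (z - g)]. *)
Lemma polyfunMX p : polyfun m (p * 'X) = polyfun a (divdiff m p).
Proof.
rewrite -[p]coefK poly_def mulr_suml (linear_sum (divdiff m)) !linear_sum /=.
apply: eq_bigr => i _.
rewrite -scalerAl !linearZ /=; congr (_ * _).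
rewrite -exprSr polyfunXn divdiffXn polyfun_poly.
case: (nat_of_ord i) => [|n]; first by rewrite big_ord0 m1.
by rewrite mSS; apply: eq_bigr => j _; rewrite mulrC.
Qed.

(** The inner product of [p(T) e] and [q(T) e] for the symmetric operator
    [T (c, f) = (L_a f, c + x f)] and [e = (1, 0)], since [q(T) e = (L_m q, D q)]. The induction
    moves a factor ['X] from [p] to [q], which is the symmetry of [T]. *)
Lemma polyfunM p q :
  polyfun m (p * q) =
  polyfun m p * polyfun m q + polyfun a (divdiff m p * divdiff m q).
Proof.
elim/poly_ind: p q => [|p c IH] q.
  by rewrite mul0r !linear0 !mul0r add0r linear0.
rewrite mulrDl !linearD /= mul_polyC linearZ /= polyfunC // divdiffC addr0.
rewrite -mulrA (mulrC 'X) IH polyfunMX !divdiffMX polyfunMX.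
rewrite !mulrDl !mulrDr !linearD /= mul_polyC linearZ /= [_ * _%:P]mulrC.
rewrite mul_polyC linearZ /= -mulrA [divdiff m q * _]mulrC !mulrA.
ring.
Qed.

(** The factorization of [u^k - v^k] with [u = x - w] and [v = y - w], whose difference is [x - y].
    It serves to bound the divided differences of the remainders of a geometric series about [w]. *)
Lemma divdiff_shift w k : divdiff m (('X - w%:P) ^+ k) =
  \sum_(p < k) polyfun m (('X - w%:P) ^+ (k.-1 - p)) *: ('X - w%:P) ^+ p.
Proof.
elim: k => [|k IH]; first by rewrite expr0 divdiffC big_ord0.
rewrite exprSr mulrBr linearB /= divdiffMX [_ * w%:P]mulrC mul_polyC linearZ /=.
rewrite -addrA -mul_polyC [_%:P * divdiff _ _]mulrC -mulrBr IH.
rewrite big_ord_recl /= subn0 expr0 alg_polyC.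
congr (_ + _); rewrite mulr_suml; apply: eq_bigr => i _.
rewrite -scalerAl -exprSr /bump /= add1n; congr (polyfun _ (_ ^+ _) *: _).
by case: k i {IH} => [[]//|k] i /=; lia.
Qed.

End MomentFunctional.

(** * Positivity of the functional defined by the recursion *)

Section JacobiPositivity.
Variable F : realFieldType.
Variables a m : nat -> F.
Variable M : F.
Hypothesis a0 : a 0%N = 1.
Hypothesis m0 : m 0%N = 1.
Hypothesis m1 : m 1%N = 0.
Hypothesis mSS : forall r, m r.+2 = \sum_(p < r.+1) a p * m (r - p)%N.
Hypothesis M0 : 0 <= M.
Hypothesis a_ge0 : forall p : {poly F},
  (forall x, `|x| <= M -> 0 <= p.[x]) -> 0 <= polyfun a p.
Implicit Types p q f : {poly F}.

Let mM := polyfunM m0 m1 mSS.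

(** Nonnegativity of the variance [L_a ((f - c)^2)] with [c = L_a f]. *)
Lemma polyfun_sqr_le f : polyfun a f ^+ 2 <= polyfun a (f * f).
Proof.
set c := polyfun a f.
have: 0 <= polyfun a ((f - c%:P) * (f - c%:P)).
  by apply: a_ge0 => x _; rewrite !hornerE -expr2 sqr_ge0.
have -> : (f - c%:P) * (f - c%:P) = f * f - (2 * c) *: f + (c ^+ 2)%:P.
  by rewrite -mul_polyC !rmorphM /=; ring.
by rewrite linearD linearB linearZ /= polyfunC// -/c; lra.
Qed.

Lemma jacobi_sqr_ge0 q : 0 <= polyfun m (q * q).
Proof.
rewrite mM addr_ge0 -?expr2 ?sqr_ge0//.
by apply: a_ge0 => x _; rewrite !hornerE -?expr2 sqr_ge0.
Qed.

(** For [e = 1] or [e = -1], this is the quadratic form of [1 + M + e T] at [(A, f) = q(T) (1, 0)]: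
    the integral against [a] of a polynomial in [x] that is nonnegative on [[-M, M]]. *)
Lemma jacobi_linear_ge0 (e : F) q : e ^+ 2 = 1 ->
  0 <= polyfun m (((1 + M)%:P + e *: 'X) * (q * q)).
Proof.
move=> e2; set A := polyfun m q; set f := divdiff m q.
have -> : ((1 + M)%:P + e *: 'X) * (q * q) =
    (1 + M) *: (q * q) + e *: (q * (q * 'X)).
  by rewrite -!mul_polyC; ring.
rewrite linearD !linearZ /= (mM q q) (mM q (q * 'X)) divdiffMX -/A -/f (polyfunMX m1 mSS) -/f.
have <- : polyfun a ((1 + M) *: ((A * A)%:P + f * f) +
      e *: (A *: f + f * (A%:P + f * 'X))) =
    (1 + M) * (A * A + polyfun a (f * f)) +
       e * (A * polyfun a f + polyfun a (f * (A%:P + f * 'X))).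
  by rewrite linearD !linearZ /= !linearD !linearZ /= polyfunC.
apply: a_ge0 => x; rewrite !hornerE ler_norml => /andP[x1 x2].
set y := f.[x].
have -> : (1 + M) * (A * A + y * y) + e * (A * y + y * (A + y * x)) =
  (A + e * y) ^+ 2 + M * A ^+ 2 + (M + e * x) * y ^+ 2.
  by rewrite -[in LHS](mul1r (y * y)) -{1}e2; ring: e2.
have ex : 0 <= M + e * x by have [->|->] : e = 1 \/ e = -1; [|lra|lra];
  move/eqP: e2; rewrite sqrf_eq1 => /orP[]/eqP; tauto.
by rewrite !addr_ge0// ?sqr_ge0// mulr_ge0// sqr_ge0.
Qed.

(** The quadratic form of [(1 + M)^2 - T^2] at the same vector, where the squared norm of [T (A, f)]
    contains [(L_a f)^2]. Once this is bounded by [L_a (f f)], positivity can be checked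
    pointwise. *)
Lemma jacobi_quadratic_ge0 q :
  0 <= polyfun m (((1 + M)%:P + 'X) * ((1 + M)%:P - 'X) * (q * q)).
Proof.
set A := polyfun m q; set f := divdiff m q.
have -> : ((1 + M)%:P + 'X) * ((1 + M)%:P - 'X) * (q * q) =
    (1 + M) ^+ 2 *: (q * q) - (q * 'X) * (q * 'X).
  by rewrite -!mul_polyC rmorphXn /=; ring.
rewrite linearB linearZ /= (mM q q) (mM (q * 'X)) divdiffMX -/A -/f (polyfunMX m1 mSS) -/f.
have := polyfun_sqr_le f.
set c := polyfun a f => c2.
have : 0 <= polyfun a ((1 + M) ^+ 2 *: ((A * A)%:P + f * f) - f * f -
   (A%:P + f * 'X) * (A%:P + f * 'X)).
  apply: a_ge0 => x; rewrite !hornerE ler_norml => /andP[x1 x2].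
  set y := f.[x].
  have -> : (1 + M) ^+ 2 * (A * A + y * y) - y * y -
      (A + y * x) * (A + y * x) =
    2^-1 * ((M + x) * (A - y) ^+ 2 + (M - x) * (A + y) ^+ 2) +
    (M * A ^+ 2 + M ^+ 2 * A ^+ 2 + M * y ^+ 2 + (M - x) * (M + x) * y ^+ 2).
    by field.
  have xM : 0 <= M + x by lra. 
  have Mx : 0 <= M - x by lra.
  move: (M + x) xM (M - x) Mx => u u0 v v0.
  by do ?[exact: sqr_ge0 | apply: addr_ge0 | apply: mulr_ge0];
    rewrite ?invr_ge0 ?ler0n.
rewrite !linearB linearZ linearD /= polyfunC//.
lra.
Qed.

(* [1 + M] bounds the norm of the operator [(c, f) |-> (L_a f, c + x f)], whose
   moments at the vector [(1, 0)] are the [m r]. *)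
Lemma jacobi_ge0 i j :
  0 <= polyfun m (((1 + M)%:P + 'X) ^+ i * ((1 + M)%:P - 'X) ^+ j).
Proof.
set u := _ + 'X; set v := _ - 'X.
(* Only the parities of [i] and [j] matter; the remaining factors form a square. *)
have E k (w : {poly F}) : w ^+ k = w ^+ (odd k) * (w ^+ k./2 * w ^+ k./2).
  by rewrite -exprD addnn -exprD odd_double_half.
rewrite (E i) (E j); set p := _ ^+ i./2; set q := _ ^+ j./2.
have -> : u ^+ odd i * (p * p) * (v ^+ odd j * (q * q)) =
  u ^+ odd i * v ^+ odd j * (p * q * (p * q)) by ring.
case: (odd i); case: (odd j); rewrite ?expr0 ?expr1 ?mul1r ?mulr1.
- exact: jacobi_quadratic_ge0.
- by rewrite /u -(scale1r 'X) jacobi_linear_ge0// expr1n.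
- by rewrite /v -scaleN1r jacobi_linear_ge0// sqrrN expr1n.
- exact: jacobi_sqr_ge0.
Qed.

End JacobiPositivity.

(** * Words and Condition A *)

Fixpoint words (n m : nat) : seq (seq nat) :=
  if m is m'.+1 then [seq k :: w | k <- iota 0 n, w <- words n m'] else [:: [::]].

Lemma size_words n m w : w \in words n m -> size w = m.
Proof.
elim: m w => [|m IH] w /=; first by rewrite inE => /eqP ->.
by case/allpairsP=> -[k v] /= [_ /IH <- ->].
Qed.

Lemma big_words_cons (V : nmodType) n m (f : seq nat -> V) :
  \sum_(w <- words n m.+1) f w =
  \sum_(k <- iota 0 n) \sum_(w <- words n m) f (k :: w).
Proof. by rewrite /= big_allpairs_dep. Qed.

Lemma big_words_cat (V : nmodType) n p q (f : seq nat -> seq nat -> V) :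
  \sum_(w <- words n (p + q)) f (take p w) (drop p w) =
  \sum_(u <- words n p) \sum_(v <- words n q) f u v.
Proof.
elim: p f => [|p IH] f.
  rewrite [words n 0]/= big_seq1 add0n.
  by apply: eq_bigr => w _; rewrite take0 drop0.
rewrite addSn !big_words_cons; apply: eq_bigr => k _ /=.
exact: (IH (fun u v => f (k :: u) v)).
Qed.

Lemma expr_sum_words (A : pzRingType) (X : nat -> A) n m :
  (\sum_(j < n) X j) ^+ m = \sum_(w <- words n m) \prod_(j <- w) X j.
Proof.
rewrite -(big_mkord xpredT X) /index_iota subn0.
elim: m => [|m IH]; first by rewrite expr0 big_seq1 big_nil.
rewrite exprS IH big_words_cons big_distrl; apply: eq_bigr => k _.
by rewrite big_distrr; apply: eq_bigr => w _; rewrite big_cons.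
Qed.

Lemma sum_mem_iota_le n (w : seq nat) :
  (\sum_(k <- iota 0 n) (k \in w) <= size w)%N.
Proof.
rewrite -big_mkcond /= sum1_count -size_filter uniq_leq_size//.
  by rewrite filter_uniq// iota_uniq.
by move=> x; rewrite mem_filter => /andP[].
Qed.

(** The first letter of a word of length [m + 1] either occurs in the tail, with at most [m]
    choices, or is new, with at most [n] choices and one distinct letter fewer left for the tail;
    and [(m + 1) m! = (m + 1)!]. *)
Lemma count_words_le (n m d : nat) : (0 < n)%N ->
  (\sum_(w <- words n m) (size (undup w) <= d) <= n ^ d * m`!)%N.
Proof.
move=> n0; elim: m d => [|m IH] d.
  by rewrite big_seq1 /= fact0 muln1 expn_gt0 n0.
rewrite big_words_cons exchange_big /=.
apply: (@leq_trans (\sum_(w <- words n m)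
    (m * (size (undup w) <= d) + n * (size (undup w) < d)))%N).
  rewrite [leqLHS]big_seq [leqRHS]big_seq.
  apply: leq_sum => w /size_words sw.
  apply: (@leq_trans (\sum_(k <- iota 0 n) ((k \in w) * (size (undup w) <= d)
     + (size (undup w) < d)))%N).
    apply: leq_sum => k _.
    by case: (k \in w) => /=; rewrite ?mul1n ?mul0n ?leq_addr.
  rewrite big_split /= -big_distrl /= leq_add//.
    by rewrite leq_mul2r -sw sum_mem_iota_le orbT.
  by rewrite big_const_seq count_predT size_iota iter_addn_0 mulnC.
rewrite big_split /= -!big_distrr /=.
apply: (@leq_trans (m * (n ^ d * m`!) + n ^ d * m`!)).
  rewrite leq_add ?leq_mul2l ?IH ?orbT//.
  case: d => [|d]; first by rewrite big1 ?muln0.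
  by rewrite expnS -mulnA leq_mul2l IH orbT.
by rewrite factS; lia.
Qed.

Lemma sum_count_mem_undup (T : eqType) (w : seq T) :
  (\sum_(j <- undup w) count_mem j w = size w)%N.
Proof.
rewrite -[RHS](perm_size (perm_count_undup w)) size_flatten sumnE !big_map.
by apply: eq_bigr => j _; rewrite size_nseq.
Qed.

Lemma size_undup_double (T : eqType) (w : seq T) :
  (forall j, j \in w -> (2 <= count_mem j w)%N) ->
  ((size (undup w)).*2 <= size w)%N.
Proof.
move=> w2; rewrite -[leqRHS]sum_count_mem_undup -muln2 mulnC -sum1_size big_distrr.
rewrite [leqLHS]big_seq [leqRHS]big_seq; apply: leq_sum => j.
by rewrite mem_undup => /w2.
Qed.

(** A third occurrence of one letter makes the bound strict, which later gains a factor
    [1 / sqrt n]. *)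
Lemma size_undup_double_lt (T : eqType) (w : seq T) k : k \in w ->
  (2 < count_mem k w)%N -> (forall j, j \in w -> (2 <= count_mem j w)%N) ->
  ((size (undup w)).*2 < size w)%N.
Proof.
move=> kw k3 w2; rewrite -[ltnRHS]sum_count_mem_undup.
have ku : k \in undup w by rewrite mem_undup.
rewrite -muln2 mulnC -sum1_size big_distrr /= !(big_rem k ku) /= muln1.
rewrite -addSn leq_add// [leqLHS]big_seq [leqRHS]big_seq; apply: leq_sum => j.
by move=> /mem_rem; rewrite mem_undup => /w2.
Qed.

Section BoundedSums.
Variable K : numDomainType.

Lemma sum_words_bound n m d (f : seq nat -> K) (B : K) : (0 < n)%N -> 0 <= B ->
  (forall w, size w = m -> `|f w| <= B) ->
  (forall w, size w = m -> f w != 0 -> (size (undup w) <= d)%N) ->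
  `|\sum_(w <- words n m) f w| <= B * (n ^ d * m`!)%:R.
Proof.
move=> n0 B0 fB f0; apply: (le_trans (ler_norm_sum _ _ _)).
apply: (@le_trans _ _ (B * (\sum_(w <- words n m) (size (undup w) <= d))%:R)).
  rewrite natr_sum mulr_sumr big_seq [leRHS]big_seq; apply: ler_sum => w.
  move=> /size_words sw; have [->|fw] := eqVneq (f w) 0.
    by rewrite normr0 mulr_ge0.
  by rewrite f0// mulr1 fB.
by rewrite ler_wpM2l// ler_nat count_words_le.
Qed.

End BoundedSums.

Arguments words : simpl never.


Section LinearFunctional.
Variables (R : realType) (A : algType R[i]) (om : A -> R[i]).
Hypothesis om_lin : forall (c : R[i]) x y, om (c *: x + y) = c * om x + om y.

Lemma functional0 : om 0 = 0.
Proof. by have := om_lin (-1) 0 0; rewrite scaler0 addr0 mulN1r addNr. Qed.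

Lemma functionalZ c x : om (c *: x) = c * om x.
Proof. by rewrite -[c *: x]addr0 om_lin functional0 addr0. Qed.

Lemma functional_sum (I : Type) (r : seq I) (f : I -> A) :
  om (\sum_(i <- r) f i) = \sum_(i <- r) om (f i).
Proof.
apply: (big_morph om _ functional0) => x y.
by rewrite -[x]scale1r om_lin mul1r scale1r.
Qed.

End LinearFunctional.

Lemma count1_split (T : eqType) (j : T) w : count_mem j w = 1%N ->
  exists u v, [/\ w = u ++ j :: v, j \notin u & j \notin v].
Proof.
move=> c1; have jw : j \in w by rewrite -has_pred1 has_count c1.
case/splitPr: jw c1 => u v; rewrite count_cat /= eqxx add1n addnS => -[/eqP].
rewrite addn_eq0 => /andP[u0 v0]; exists u, v; split => //.
  by rewrite -has_pred1 has_count -eqn0Ngt.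
by rewrite -has_pred1 has_count -eqn0Ngt.
Qed.

(** * Consequences of Condition A for words *)

Section Kargin.
Variables (R : realType) (A : algType R[i]) (phi psi : A -> R[i]) (X : nat -> A).
Hypothesis phi_lin : forall (c : R[i]) x y, phi (c *: x + y) = c * phi x + phi y.
Hypothesis psi_lin : forall (c : R[i]) x y, psi (c *: x + y) = c * psi x + psi y.
Hypothesis phi1 : phi 1 = 1.
Hypothesis psi_tr : tracial psi.
Hypothesis condA : kargin_conditionA phi psi X.

Lemma wprod_cat u v : wprod X (u ++ v) = wprod X u * wprod X v.
Proof. exact: big_cat. Qed.

Lemma wprod_cons k v : wprod X (k :: v) = X k * wprod X v.
Proof. exact: big_cons. Qed.

Lemma wprod_nil : wprod X [::] = 1.
Proof. exact: big_nil. Qed.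

Lemma phi_singleton j w : count_mem j w = 1%N -> phi (wprod X w) = 0.
Proof.
case/count1_split => u [v [-> ju jv]].
have juv : j \notin u ++ v by rewrite mem_cat negb_or ju.
have [/(_ (size u)) + _] := condA.1 _ _ juv.
rewrite size_cat leq_addr take_size_cat// drop_size_cat// => <-//.
by rewrite wprod_cat wprod_cons mulrA.
Qed.

(** Traciality rotates the isolated letter to the front, where Condition A (i) applies to [psi]. *)
Lemma psi_singleton j w : count_mem j w = 1%N -> psi (wprod X w) = 0.
Proof.
case/count1_split => u [v [-> ju jv]].
have jvu : j \notin v ++ u by rewrite mem_cat negb_or ju jv.
have [_ <-] := condA.1 _ _ jvu.
by rewrite !wprod_cat wprod_cons psi_tr mulrA.
Qed.

Lemma phi_pair k u v : k \notin u -> k \notin v ->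
  phi (wprod X (k :: u ++ k :: v)) =
  phi (X k ^+ 2) * psi (wprod X u) * phi (wprod X v).
Proof.
move=> ku kv; have kuv : k \notin u ++ v by rewrite mem_cat negb_or ku.
have := condA.2 k (u ++ v) (size u) kuv.
rewrite size_cat leq_addr take_size_cat// drop_size_cat// => <-//.
by rewrite !(wprod_cons, wprod_cat) !mulrA.
Qed.

(** The value that Condition A (ii) gives to [k :: u ++ v] when [v] begins with the partner of [k].
    The sums below never meet an empty [v]. *)
Definition pairing_term k (u v : seq nat) : R[i] :=
  if v is k' :: v' then
    (k' == k)%:R * (phi (X k ^+ 2) * psi (wprod X u) * phi (wprod X v'))
  else 0.

(** The error made by treating each occurrence of [k] in [w] in turn as the only partner of the
    first letter. *)
Definition pairing_defect k (w : seq nat) : R[i] :=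
  phi (wprod X (k :: w)) -
  \sum_(p < size w) pairing_term k (take p w) (drop p w).

Lemma pairing_termE k w p : (p < size w)%N ->
  pairing_term k (take p w) (drop p w) =
  (nth 0%N w p == k)%:R *
    (phi (X k ^+ 2) * psi (wprod X (take p w)) * phi (wprod X (drop p.+1 w))).
Proof. by move=> pw; rewrite (drop_nth 0%N pw). Qed.

Lemma count_take_drop (w : seq nat) p j : (p < size w)%N ->
  count_mem j w = (count_mem j (take p w) + (nth 0%N w p == j) +
                   count_mem j (drop p.+1 w))%N.
Proof.
move=> pw; rewrite -{1}(cat_take_drop p w) (drop_nth 0%N pw) count_cat /=.
by rewrite addnA.
Qed.

Lemma count1_nth_inj (w : seq nat) p q j : (p < size w)%N -> (q < size w)%N ->
  count_mem j w = 1%N -> nth 0%N w p = j -> nth 0%N w q = j -> p = q.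
Proof.
move=> + + c1; wlog pq : p q / (p <= q)%N => [H pw qw pj qj|].
  by case: (leqP p q) => [|/ltnW] pq; [|apply/esym]; apply: H.
move=> pw qw pj qj; move: pq; rewrite leq_eqVlt => /orP[/eqP//|pq].
have := count_take_drop j pw; rewrite c1 pj eqxx.
suff : (0 < count_mem j (drop p.+1 w))%N by lia.
rewrite -has_count has_pred1 -qj -(subnKC pq) -nth_drop mem_nth//.
by rewrite size_drop ltn_sub2r// (leq_trans _ qw).
Qed.

(* When the first letter is matched exactly once Condition A (ii) applies; any
   other word with a singleton letter kills both sides of the recursion. *)
Lemma pairing_defect_eq0 k w : pairing_defect k w != 0 ->
  (2 < count_mem k (k :: w))%N /\
  forall j, j \in k :: w -> (2 <= count_mem j (k :: w))%N.
Proof.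
move=> d0.
have kk : (2 < count_mem k (k :: w))%N.
  rewrite /= eqxx add1n ltnS ltnNge; apply: contra d0.
  rewrite leq_eqVlt => /orP[/eqP c1|].
    (* One occurrence of [k] in [w]: the sum reduces to the term at its position, which Condition A
       (ii) identifies. *)
    have [u [v [wE ku kv]]] := count1_split c1.
    have su : (size u < size w)%N by rewrite wE size_cat /= addnS ltnS leq_addr.
    rewrite /pairing_defect (bigD1 (Ordinal su)) //= big1 => [|p].
      rewrite addr0 pairing_termE// {1 2}wE nth_cat ltnn subnn /= eqxx mul1r.
      rewrite wE take_size_cat// -cat_rcons drop_size_cat ?size_rcons//.
      by rewrite cat_rcons phi_pair// subrr.
    rewrite -val_eqE /= => pu; rewrite pairing_termE//.
    case: eqP => [pk|]; last by rewrite mul0r.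
    case/eqP: pu; apply: (count1_nth_inj (ltn_ord p) su c1 pk).
    by rewrite wE nth_cat ltnn subnn.
  (* No occurrence of [k] in [w]: [phi] kills the word, and no position matches. *)
  rewrite ltnS leqn0 => /eqP c0.
  rewrite /pairing_defect big1 ?subr0 => [|p _].
    by rewrite (@phi_singleton k)//= eqxx c0.
  rewrite pairing_termE//; case: eqP => [pk|]; last by rewrite mul0r.
  by have := count_take_drop k (ltn_ord p); rewrite c0 pk eqxx addn1.
split=> // j jw; rewrite leqNgt; apply: contra d0.
have : (0 < count_mem j (k :: w))%N by rewrite -has_count has_pred1.
rewrite ltnS => j0 j1; have c1 : count_mem j (k :: w) = 1%N by lia.
have jk : (k == j) = false by apply/eqP => jk; move: kk; have -> : k = j by []; rewrite -{2}jk c1.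
rewrite /pairing_defect (phi_singleton c1) big1 ?subr0// => p _.
rewrite pairing_termE//; case: eqP => [pk|]; last by rewrite mul0r.
move: c1; rewrite /= jk add0n (count_take_drop j (ltn_ord p)) pk jk addn0.
(* The isolated letter [j] differs from [k], so it lies in exactly one of the two factors. *)
case E : (count_mem j (take p w)) => [|[|n]] // c1.
  by rewrite [phi (wprod _ _)](@phi_singleton j) ?mulr0.
by rewrite (@psi_singleton j)// mulr0 mul0r mulr0.
Qed.

Lemma functional_expr (om : A -> R[i]) n m :
  (forall (c : R[i]) x y, om (c *: x + y) = c * om x + om y) ->
  om ((\sum_(j < n) X j) ^+ m) = \sum_(w <- words n m) om (wprod X w).
Proof. by move=> om_lin; rewrite expr_sum_words functional_sum. Qed.

(** In [k u k v] the words [u] and [v] range freely, even over words containing [k], so the pairing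
    terms sum to products of moments; what is left over is the sum of the defects. *)
Lemma moment_recursion n r :
  phi ((\sum_(j < n) X j) ^+ r.+2) -
  \sum_(p < r.+1) (\sum_(k < n) phi (X k ^+ 2)) *
     psi ((\sum_(j < n) X j) ^+ p) * phi ((\sum_(j < n) X j) ^+ (r - p)) =
  \sum_(w <- words n r.+2) (if w is k :: w' then pairing_defect k w' else 0).
Proof.
rewrite functional_expr// !big_words_cons.
rewrite -(big_mkord xpredT (fun k => phi (X k ^+ 2))) /index_iota subn0.
have -> : \sum_(k <- iota 0 n) \sum_(w <- words n r.+1) pairing_defect k w =
  \sum_(k <- iota 0 n) \sum_(w <- words n r.+1) phi (wprod X (k :: w)) -
  \sum_(k <- iota 0 n) \sum_(w <- words n r.+1)
    \sum_(p < r.+1) pairing_term k (take p w) (drop p w).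
  rewrite -sumrB; apply: eq_bigr => k _; rewrite -sumrB.
  rewrite big_seq [RHS]big_seq; apply: eq_bigr => w /size_words sw.
  by rewrite /pairing_defect sw.
congr (_ - _).
transitivity (\sum_(p < r.+1) \sum_(k <- iota 0 n) \sum_(w <- words n r.+1)
    pairing_term k (take p w) (drop p w)); last first.
  rewrite exchange_big; apply: eq_bigr => k _; exact: exchange_big.
apply: eq_bigr => -[p /= pr] _; rewrite !functional_expr//.
rewrite -mulrA big_distrl /= big_seq [RHS]big_seq; apply: eq_bigr => k kn.
have -> : r.+1 = (p + (r - p).+1)%N by rewrite addnS subnKC.
rewrite (big_words_cat _ _ _ (pairing_term k)) /= mulr_suml mulr_sumr.
apply: eq_bigr => u _; rewrite big_words_cons /=.
(* Among the letters at the matching position only [k] itself contributes. *)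
rewrite mulr_sumr mulr_sumr (bigD1_seq k) ?iota_uniq//= [X in _ = _ + X]big1.
  by rewrite addr0; apply: eq_bigr => v _; rewrite eqxx mul1r mulrA.
by move=> k' /negbTE k'k; rewrite big1// => v _; rewrite k'k mul0r.
Qed.

End Kargin.

(** * Limits of the normalized moments *)

Section ComplexLimits.
Variable R : realType.
Implicit Types (u v : nat -> R[i]) (k l : R[i]).

Lemma gt0_realE (e : R[i]) : 0 < e -> e = (complex.Re e)%:C /\ 0 < complex.Re e.
Proof. by case: e => a b; rewrite ltcE /= => /andP[/eqP -> ->]. Qed.

(** A positive complex number is real, so the real [eps] of [cvgC] covers every complex
    tolerance. *)
Lemma cvgCP u l : cvgC u l <->
  ((u : nat -> (R[i] : numFieldType)) @ \oo --> (l : (R[i] : numFieldType))).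
Proof.
split=> [ul|/cvgrPdist_lt ul e e0].
  apply/cvgrPdist_lt => e /gt0_realE[-> e0].
  by have [N H] := ul _ e0; exists N => // n /H /=; rewrite distrC.
have := ul e%:C; rewrite ltcR => /(_ e0) [N _ H].
by exists N => n /H /=; rewrite distrC.
Qed.

Lemma cvgC_cst l : cvgC (fun=> l) l.
Proof. by move=> e e0; exists 0%N => n _; rewrite subrr normr0 ltcR. Qed.

Lemma cvgCD u v k l : cvgC u k -> cvgC v l -> cvgC (fun n => u n + v n) (k + l).
Proof. by rewrite !cvgCP; exact: cvgD. Qed.

Lemma cvgCM u v k l : cvgC u k -> cvgC v l -> cvgC (fun n => u n * v n) (k * l).
Proof. by rewrite !cvgCP; exact: cvgM. Qed.

Lemma cvgCV u l : l != 0 -> cvgC u l -> cvgC (fun n => (u n)^-1) l^-1.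
Proof. by rewrite !cvgCP; exact: cvgV. Qed.

Lemma cvgCX u l m : cvgC u l -> cvgC (fun n => u n ^+ m) (l ^+ m).
Proof.
move=> ul; elim: m => [|m IH]; first exact: cvgC_cst.
by rewrite exprS; under eq_fun do rewrite exprS; exact: cvgCM.
Qed.

Lemma cvgC_sum (I : Type) (r : seq I) (f : I -> nat -> R[i]) (l : I -> R[i]) :
  (forall i, cvgC (f i) (l i)) ->
  cvgC (fun n => \sum_(i <- r) f i n) (\sum_(i <- r) l i).
Proof.
move=> fl; elim: r => [|i r IH].
  by rewrite big_nil; under eq_fun do rewrite big_nil; exact: cvgC_cst.
by rewrite big_cons; under eq_fun do rewrite big_cons; exact: cvgCD.
Qed.

Lemma cvgC_eq u v l N : (forall n, (N <= n)%N -> u n = v n) ->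
  cvgC u l -> cvgC v l.
Proof.
move=> uv ul e e0; have [M H] := ul e e0; exists (maxn N M) => n.
by rewrite geq_max => /andP[Nn Mn]; rewrite -uv// H.
Qed.

Lemma cvgC_le0 u v N : (forall n, (N <= n)%N -> `|u n| <= `|v n|) ->
  cvgC v 0 -> cvgC u 0.
Proof.
move=> uv v0 e e0; have [M H] := v0 e e0; exists (maxn N M) => n.
rewrite geq_max => /andP[Nn Mn]; rewrite subr0 (le_lt_trans (uv _ Nn))//.
by have := H n Mn; rewrite subr0.
Qed.

Lemma cvgC_sqr0 u : cvgC (fun n => u n ^+ 2) 0 -> cvgC u 0.
Proof.
move=> u0 e e0; have [N H] := u0 (e ^+ 2) (exprn_gt0 2 e0); exists N => n /H.
by rewrite !subr0 normrX rmorphXn /= ltr_pXn2r// ?nnegrE ?normr_ge0// lecR ltW.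
Qed.

Lemma cvgC_unique u k l : cvgC u k -> cvgC u l -> k = l.
Proof. by rewrite !cvgCP => uk ul; exact: cvg_unique uk ul. Qed.

Lemma cvgC_neq0 u l : l != 0 -> cvgC u l ->
  exists N, forall n, (N <= n)%N -> u n != 0.
Proof.
move=> l0 ul; have nl : 0 < `|l| by rewrite normr_gt0.
have [lE e0] := gt0_realE nl.
have [N H] := ul _ e0; exists N => n /H; rewrite -lE; apply: contraTneq => ->.
by rewrite sub0r normrN ltxx.
Qed.

Lemma sqrtn_gt0 n : (0 < n)%N -> 0 < sqrtC (n%:R : R[i]).
Proof. by move=> n0; rewrite sqrtC_gt0 ltr0n. Qed.

Lemma cvgC_inv_sqrtn : cvgC (fun n => (sqrtC (n%:R : R[i]))^-1) 0.
Proof.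
apply: cvgC_sqr0 => e e0.
pose N := (Num.truncn e^-1).+1; exists N => n Nn.
have n0 : (0 < n)%N by rewrite (leq_trans _ Nn).
rewrite subr0 exprVn sqrtCK ger0_norm ?invr_ge0 ?ler0n//.
rewrite -(rmorph_nat (real_complex R)) -fmorphV ltcR.
rewrite invf_plt ?posrE ?ltr0n// (lt_le_trans (truncnS_gt _))// ler_nat.
exact: Nn.
Qed.

(** At least one factor [sqrt n] of the denominator survives the cancellation, and the others are at
    least [1]. *)
Lemma pown_div_sqrtn n d m : (0 < n)%N -> (d.*2 < m)%N ->
  (n ^ d)%:R / sqrtC (n%:R : R[i]) ^+ m <= (sqrtC n%:R)^-1.
Proof.
move=> n0 dm; set r := sqrtC _; have r0 : 0 < r by exact: sqrtn_gt0.
have r1 : 1 <= r by rewrite -(@expr_ge1 _ 2) ?(ltW r0)// /r sqrtCK ler1n.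
have -> : m = (d.*2 + (m - d.*2).-1.+1)%N by lia.
have -> : (n ^ d)%:R = r ^+ d.*2 :> R[i].
  by rewrite -mul2n exprM sqrtCK natrX.
rewrite exprD invfM mulrA divff ?mul1r ?expf_neq0 ?gt_eqF//.
rewrite exprS invfM ler_piMr ?invr_ge0 ?(ltW r0)//.
by rewrite invf_le1 ?exprn_gt0// exprn_ege1.
Qed.

(** Nonzero terms come from at most [m! n^h] words, with [h] the integer part of [(m - 1) / 2],
    while the normalization is [n^(m / 2)]. *)
Lemma sum_words_cvg0 m (f : seq nat -> R[i]) (B : R[i]) : 0 <= B ->
  (forall w, size w = m -> `|f w| <= B) ->
  (forall w, size w = m -> f w != 0 -> ((size (undup w)).*2 < m)%N) ->
  cvgC (fun n => (\sum_(w <- words n m) f w) / sqrtC n%:R ^+ m) 0.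
Proof.
move=> B0 fB f0.
apply: (@cvgC_le0 _ (fun n => (B * m`!%:R) * (sqrtC n%:R)^-1) 1%N); last first.
  by rewrite -(mulr0 (B * m`!%:R)); exact: cvgCM (cvgC_cst _) cvgC_inv_sqrtn.
move=> n n0.
have H w : size w = m -> f w != 0 -> (size (undup w) <= m.-1./2)%N.
  move=> sw fw; have := f0 w sw fw.
  by rewrite geq_half_double; case: (m).
rewrite normf_div normrX (ger0_norm (ltW (sqrtn_gt0 n0))).
rewrite [leRHS]ger0_norm; last first.
  by rewrite !mulr_ge0 ?ler0n// invr_ge0 ltW// sqrtn_gt0.
(* For [m = 0], [f0] forces every term to vanish; the comparison of exponents requires [m]
   positive. *)
have [m0|m0] := posnP m.
  have -> : \sum_(w <- words n m) f w = 0.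
    rewrite big_seq big1// => w /size_words sw; apply/eqP; apply/negPn/negP => fw.
    by have := f0 w sw fw; rewrite m0.
  by rewrite normr0 mul0r !mulr_ge0 ?ler0n// invr_ge0 ltW// sqrtn_gt0.
apply: (@le_trans _ _ (B * (n ^ m.-1./2 * m`!)%:R / sqrtC n%:R ^+ m)).
  rewrite ler_wpM2r ?invr_ge0 ?exprn_ge0 ?(ltW (sqrtn_gt0 n0))//.
  exact: sum_words_bound.
rewrite natrM mulrA [_ * m`!%:R]mulrC mulrA [m`!%:R * B]mulrC -!mulrA.
rewrite ler_wpM2l// ler_wpM2l ?ler0n// pown_div_sqrtn//.
by case: (m) m0 => // k _ /=; rewrite ltnS -[leqRHS]odd_double_half leq_addl.
Qed.

End ComplexLimits.

(** * Passing between normalization by the variances and by [sqrt n] *)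

Section NormalizedSums.
Variables (R : realType) (A : algType R[i]) (om : A -> R[i]) (X : nat -> A).
Hypothesis om_lin : forall (c : R[i]) x y, om (c *: x + y) = c * om x + om y.
Variable s : R.
Hypothesis s0 : 0 < s.
Hypothesis cvg_s :
  cvgC (fun n => (\sum_(j < n) om (X j ^+ 2)) / n%:R) (s ^+ 2)%:C.

Let T n := \sum_(j < n) X j.
Let rho n : R[i] := sqrtC n%:R.
Let sig n : R[i] := sqrtC (\sum_(j < n) om (X j ^+ 2)).

Lemma s2C_neq0 : (s ^+ 2)%:C != 0 :> R[i].
Proof. by rewrite fmorph_eq0 expf_neq0// gt_eqF. Qed.

Lemma rho_neq0 n : (0 < n)%N -> rho n != 0.
Proof. by move=> n0; rewrite gt_eqF// sqrtn_gt0. Qed.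

Lemma normalized_sumE n m : om (normalized_sum om X n ^+ m) =
  om (T n ^+ m) / sig n ^+ m.
Proof.
by rewrite /normalized_sum exprZn functionalZ// exprVn mulrC.
Qed.

(** An even power of [sqrtC] is a power of its argument, so the branch does not enter. *)
Lemma cvg_ratio_even h : cvgC (fun n => (sig n / rho n) ^+ h.*2) (s ^+ h.*2)%:C.
Proof.
have E n : (sig n / rho n) ^+ h.*2 =
    ((\sum_(j < n) om (X j ^+ 2)) / n%:R) ^+ h.
  by rewrite -mul2n exprM expr_div_n !sqrtCK.
under eq_fun do rewrite E.
by rewrite -mul2n exprM rmorphXn; exact: cvgCX.
Qed.

Lemma sig_neq0 : exists N, forall n, (N <= n)%N -> sig n != 0.
Proof.
have [N H] := cvgC_neq0 s2C_neq0 cvg_s; exists N => n /H.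
by apply: contraNneq; rewrite /sig => /eqP; rewrite sqrtC_eq0 => /eqP ->; rewrite mul0r.
Qed.

Lemma raw_of_normalized_even h l :
  cvgC (fun n => om (normalized_sum om X n ^+ h.*2)) l ->
  cvgC (fun n => om (T n ^+ h.*2) / rho n ^+ h.*2) ((s ^+ h.*2)%:C * l).
Proof.
have [N sigN] := sig_neq0.
move/(cvgCM (cvg_ratio_even h)); apply: (@cvgC_eq _ _ _ _ (maxn 1 N)) => n.
rewrite geq_max => /andP[/rho_neq0 r0 /sigN s1].
by rewrite normalized_sumE expr_div_n; field; rewrite !expf_neq0.
Qed.

Lemma normalized_of_raw_even h l :
  cvgC (fun n => om (T n ^+ h.*2) / rho n ^+ h.*2) ((s ^+ h.*2)%:C * l) ->
  cvgC (fun n => om (normalized_sum om X n ^+ h.*2)) l.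
Proof.
have [N sigN] := sig_neq0.
have sh : (s ^+ h.*2)%:C != 0 :> R[i] by rewrite fmorph_eq0 expf_neq0// gt_eqF.
move/(cvgCM (cvgCV sh (cvg_ratio_even h))); rewrite mulKf//.
apply: (@cvgC_eq _ _ _ _ (maxn 1 N)) => n.
rewrite geq_max => /andP[/rho_neq0 r0 /sigN s1].
by rewrite normalized_sumE expr_div_n; field; rewrite !expf_neq0.
Qed.

(* Squaring removes the choice of branch in [sqrtC]. *)
Lemma normalized_of_raw0 m :
  cvgC (fun n => om (T n ^+ m) / rho n ^+ m) 0 ->
  cvgC (fun n => om (normalized_sum om X n ^+ m)) 0.
Proof.
move=> /(cvgCX 2) raw0; apply: cvgC_sqr0; have [N sigN] := sig_neq0.
have sh : (s ^+ m.*2)%:C != 0 :> R[i] by rewrite fmorph_eq0 expf_neq0// gt_eqF.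
have := cvgCM (cvgCV sh (cvg_ratio_even m)) raw0; rewrite expr0n mulr0.
apply: (@cvgC_eq _ _ _ _ (maxn 1 N)) => n.
rewrite geq_max => /andP[/rho_neq0 r0 /sigN s1].
rewrite normalized_sumE -muln2 !exprM !expr_div_n.
by field; rewrite !expf_neq0.
Qed.

End NormalizedSums.

(** * Bounds on words and limits of the moments *)

Section MomentLimits.
Variables (R : realType) (A : algType R[i]) (phi psi : A -> R[i]) (X : nat -> A).
Hypothesis phi_lin : forall (c : R[i]) x y, phi (c *: x + y) = c * phi x + phi y.
Hypothesis psi_lin : forall (c : R[i]) x y, psi (c *: x + y) = c * psi x + psi y.
Hypothesis phi1 : phi 1 = 1.
Hypothesis psi_tr : tracial psi.
Hypothesis condA : kargin_conditionA phi psi X.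
Hypothesis phi_bounded : forall k : nat, exists Ck : R, forall w : seq nat,
  size w = k -> `|phi (wprod X w)| <= Ck%:C.
Variables s S : R.
Hypothesis cvg_s :
  cvgC (fun n => (\sum_(j < n) psi (X j ^+ 2)) / n%:R) (s ^+ 2)%:C.
Hypothesis cvg_S :
  cvgC (fun n => (\sum_(j < n) phi (X j ^+ 2)) / n%:R) (S ^+ 2)%:C.
Hypotheses (s0 : 0 < s) (S0 : 0 < S).

Let T n := \sum_(j < n) X j.

Lemma phi_bound m : exists B : R[i], 0 <= B /\
  forall w, size w = m -> `|phi (wprod X w)| <= B.
Proof.
have [B HB] := phi_bounded m; exists B%:C; split=> //.
by rewrite (le_trans (normr_ge0 _) (HB (nseq m 0%N) _))// size_nseq.
Qed.

(* [psi] is not assumed bounded on words; this lemma bounds it, through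
   [phi (X_k w X_k) = phi (X_k^2) psi w]. *)
Lemma large_variance (w : seq nat) :
  exists2 k, k \notin w & (S ^+ 2 / 2)%:C <= `|phi (X k ^+ 2)|.
Proof.
(* Otherwise the averages of [phi (X_j^2)] would end up at most about [S^2 / 2], since the letters
   of [w] contribute a bounded total. *)
apply: contrapT => H.
have {}H k : k \notin w -> `|phi (X k ^+ 2)| <= (S ^+ 2 / 2)%:C.
  move=> kw; rewrite ltW// real_ltNge ?normr_real ?ger0_real//.
    by apply/negP => Sk; apply: H; exists k.
  by rewrite lecR divr_ge0// sqr_ge0.
have [B HB] := phi_bounded 2.
have {}HB k : `|phi (X k ^+ 2)| <= B%:C.
  by have := HB [:: k; k] erefl; rewrite !wprod_cons wprod_nil mulr1.
have B0 : 0 <= B by rewrite -lecR (le_trans (normr_ge0 _) (HB 0%N)).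
have S20 : 0 < S ^+ 2 by rewrite exprn_gt0.
have [|N HN] := cvg_S (eps := S ^+ 2 / 4); first by rewrite divr_gt0.
(* From [N] on the average is within [S^2 / 4] of [S^2]; the second summand makes the letters of [w]
   contribute less than [n S^2 / 4]. Adding [n S^2 / 2] for the other letters gives
   [n S^2 < n S^2]. *)
pose n := (N + (Num.truncn ((size w)%:R * B * 4 / S ^+ 2)).+1)%N.
have n0 : 0 < n%:R :> R by rewrite ltr0n /n addnS.
have sumB : `|\sum_(j < n) phi (X j ^+ 2)| <=
    ((size w)%:R * B + n%:R * (S ^+ 2 / 2))%:C.
  rewrite (le_trans (ler_norm_sum _ _ _))//.
  rewrite -(big_mkord xpredT (fun j => `|phi (X j ^+ 2)|)) /index_iota subn0.
  apply: (@le_trans _ _ (\sum_(j <- iota 0 n) ((j \in w)%:R * B + S ^+ 2 / 2)%:C)).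
    apply: ler_sum => j _; case: (boolP (j \in w)) => jw.
      by rewrite mul1r (le_trans (HB j))// lecR lerDl divr_ge0// ltW.
    by rewrite mul0r add0r H.
  rewrite -rmorph_sum /= lecR big_split /= -mulr_suml -natr_sum.
  rewrite lerD ?ler_wpM2r ?ler_nat ?sum_mem_iota_le//.
  by rewrite big_const_seq count_predT size_iota iter_addr_0 mulr_natl.
have := HN n (leq_addr _ _); set u := _ / _ => uS.
have nC : n%:R = (n%:R)%:C :> R[i] by rewrite -(rmorph_nat (real_complex R)).
have E : (n%:R * S ^+ 2)%:C =
    \sum_(j < n) phi (X j ^+ 2) - n%:R * (u - (S ^+ 2)%:C).
  have nC0 : n%:R != 0 :> R[i] by rewrite nC fmorph_eq0 gt_eqF.
  by rewrite rmorphM /= nC /u -nC; field.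
have : (n%:R * S ^+ 2)%:C <=
    ((size w)%:R * B + n%:R * (S ^+ 2 / 2) + n%:R * (S ^+ 2 / 4))%:C.
  rewrite -[leLHS]ger0_norm; last by rewrite lecR mulr_ge0// ltW.
  rewrite E (le_trans (ler_normB _ _))// [leRHS]rmorphD lerD// normrM [leRHS]rmorphM.
  by rewrite nC ler_pM// ?(ltW uS)// ger0_norm// lecR ltW.
rewrite lecR => nS.
have : (size w)%:R * B * 4 / S ^+ 2 < n%:R.
  by rewrite (lt_le_trans (truncnS_gt _))// ler_nat leq_addl.
by rewrite ltr_pdivrMr// => nS'; lra.
Qed.

Lemma psi_bound m : exists B : R[i], 0 <= B /\
  forall w, size w = m -> `|psi (wprod X w)| <= B.
Proof.
have [B [B0 HB]] := phi_bound m.+2.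
have S20 : 0 < (S ^+ 2 / 2)%:C :> R[i] by rewrite ltcR divr_gt0// exprn_gt0.
exists (B / (S ^+ 2 / 2)%:C); split; first by rewrite divr_ge0// ltW.
move=> w sw; have [k kw Sk] := large_variance w.
have := HB (k :: w ++ [:: k]); rewrite /= size_cat sw addn1 => /(_ erefl).
rewrite (phi_pair condA)// wprod_nil phi1 mulr1 normrM => kB.
by rewrite ler_pdivlMr// (le_trans _ kB)// mulrC ler_wpM2r.
Qed.

Lemma defect_bound m : exists B : R[i], 0 <= B /\
  forall k w, size w = m -> `|pairing_defect phi psi X k w| <= B.
Proof.
have [B1 [B10 HB1]] := phi_bound m.+1; have [B2 [B20 HB2]] := phi_bound 2.
have [B3 HB3] := choice phi_bound; have [B4 HB4] := choice psi_bound.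
exists (B1 + \sum_(p < m) B2 * B4 p * B3 (m - p.+1)%N); split.
  rewrite addr_ge0// sumr_ge0// => p _.
  by rewrite !mulr_ge0// ?(HB4 _).1 ?(HB3 _).1.
move=> k w sw; rewrite (le_trans (ler_normB _ _))// lerD//.
  by rewrite HB1//= sw.
rewrite (le_trans (ler_norm_sum _ _ _))// sw; apply: ler_sum => p _.
rewrite pairing_termE ?sw// normrM !normrM.
have -> : X k ^+ 2 = wprod X [:: k; k] by rewrite !wprod_cons wprod_nil mulr1.
rewrite -[leRHS]mul1r ler_pM ?mulr_ge0//; first by case: eqP; rewrite ?normr1 ?normr0.
rewrite ler_pM ?mulr_ge0// ?ler_pM// ?HB2//.
  by rewrite (HB4 p).2// size_takel// sw ltnW.
by rewrite (HB3 _).2// size_drop sw.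
Qed.

(** Words without isolated letters have at most [m / 2] distinct letters, and strictly fewer when
    [m] is odd. *)
Lemma odd_moment_cvg0 om m :
  (forall (c : R[i]) x y, om (c *: x + y) = c * om x + om y) ->
  (exists B : R[i], 0 <= B /\
    forall w, size w = m -> `|om (wprod X w)| <= B) ->
  (forall j w, count_mem j w = 1%N -> om (wprod X w) = 0) -> odd m ->
  cvgC (fun n => om (T n ^+ m) / sqrtC n%:R ^+ m) 0.
Proof.
move=> om_lin [B [B0 HB]] om_single om_odd.
under eq_fun do rewrite functional_expr//.
apply: sum_words_cvg0 B0 HB _ => w sw w0.
rewrite ltn_neqAle -{2}sw size_undup_double ?andbT => [|j jw].
  by apply: contraTneq om_odd => <-; rewrite odd_double.
have : (0 < count_mem j w)%N by rewrite -has_count has_pred1.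
case: (count_mem j w) (@om_single j w) => [|[|c]]// /(_ erefl) w1.
by rewrite w1 eqxx in w0.
Qed.

(** The defects live on words without isolated letters in which one letter occurs three times, so
    they are negligible. The exponent [r + 2] splits as [2 + p + (r - p)] over the variance sum and
    the two moments. *)
Lemma moment_recursion_cvg r :
  cvgC (fun n => phi (T n ^+ r.+2) / sqrtC n%:R ^+ r.+2 -
    \sum_(p < r.+1) ((\sum_(k < n) phi (X k ^+ 2)) / n%:R) *
     (psi (T n ^+ p) / sqrtC n%:R ^+ p) *
     (phi (T n ^+ (r - p)) / sqrtC n%:R ^+ (r - p))) 0.
Proof.
have [B [B0 HB]] := defect_bound r.+1.
pose f w := if w is k :: w' then pairing_defect phi psi X k w' else 0.
apply: (@cvgC_eq _ (fun n => (\sum_(w <- words n r.+2) f w) /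
   sqrtC n%:R ^+ r.+2) _ _ 1%N); last first.
  apply: sum_words_cvg0 B0 _ _ => -[|k w]//= [sw]; first exact: HB.
  move=> /(pairing_defect_eq0 psi_tr condA)[k3 w2].
  have kw : k \in k :: w by rewrite inE eqxx.
  by have := size_undup_double_lt kw k3 w2; rewrite /= sw.
move=> n n0; rewrite -moment_recursion// mulrBl; congr (_ - _).
rewrite mulr_suml; apply: eq_bigr => -[p /= pr] _; rewrite ltnS in pr.
have rho0 : sqrtC n%:R != 0 :> R[i] by rewrite gt_eqF// sqrtn_gt0.
have -> : r.+2 = (2 + p + (r - p))%N by lia.
rewrite !exprD sqrtCK; field.
by rewrite !expf_neq0// pnatr_eq0 -lt0n n0.
Qed.

Variables nm mm : nat -> R.
Hypothesis nm_cvg : forall m,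
  cvgC (fun n => psi (normalized_sum psi X n ^+ m)) (nm m)%:C.
Hypothesis mm0 : mm 0%N = 1.
Hypothesis mm1 : mm 1%N = 0.
Hypothesis mmSS : forall r,
  mm r.+2 = \sum_(p < r.+1) ((s / S) ^+ p * nm p) * mm (r - p)%N.

Lemma psi_raw_cvg m :
  cvgC (fun n => psi (T n ^+ m) / sqrtC n%:R ^+ m) (s ^+ m * nm m)%:C.
Proof.
have := odd_double_half m; case om : (odd m) => /= mE; last first.
  rewrite -mE add0n rmorphM; apply: (raw_of_normalized_even psi_lin s0 cvg_s).
  exact: nm_cvg.
have raw0 : cvgC (fun n => psi (T n ^+ m) / sqrtC n%:R ^+ m) 0.
  by apply: odd_moment_cvg0 => //; [exact: psi_bound | exact: (psi_singleton psi_tr condA)].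
(* For odd [m] the raw limit is [0], hence so is the normalized one, and uniqueness of limits gives
   [nm m = 0]. *)
have := normalized_of_raw0 psi_lin s0 cvg_s raw0.
move=> /(cvgC_unique (nm_cvg m))/eqP; rewrite fmorph_eq0 => /eqP ->.
by rewrite mulr0.
Qed.

(** Strong induction on the recursion; [S^2 s^p S^(r - p) = S^(r + 2) (s / S)^p] is where the ratio
    [s / S] appears. *)
Lemma phi_raw_cvg m :
  cvgC (fun n => phi (T n ^+ m) / sqrtC n%:R ^+ m) (S ^+ m * mm m)%:C.
Proof.
elim/ltn_ind: m => -[|[|r]] IH.
- by under eq_fun do rewrite !expr0 phi1 divr1; rewrite mm0 mulr1; exact: cvgC_cst.
- rewrite mm1 mulr0; apply: odd_moment_cvg0 => //; first exact: phi_bound.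
  exact: (phi_singleton condA).
have := cvgCD (moment_recursion_cvg r) (@cvgC_sum _ _ (index_enum _) _ _
  (fun p : 'I_r.+1 => cvgCM (cvgCM cvg_S (psi_raw_cvg p))
     (IH (r - p)%N (leq_ltn_trans (leq_subr _ _) (ltnW (ltnSn _)))))).
under eq_fun do rewrite subrK.
congr (cvgC _ _); rewrite add0r mmSS mulr_sumr rmorph_sum.
apply: eq_bigr => -[p /= pr] _; rewrite -!rmorphM; congr _%:C.
have -> : r.+2 = (2 + p + (r - p))%N by lia.
by rewrite !exprD expr_div_n; field; rewrite expf_neq0// gt_eqF.
Qed.

Lemma phi_moment_cvg m :
  cvgC (fun n => phi (normalized_sum phi X n ^+ m)) (mm m)%:C.
Proof.
have := odd_double_half m; case om : (odd m) => /= mE; last first.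
  have := phi_raw_cvg m; rewrite -mE add0n rmorphM.
  exact: (normalized_of_raw_even phi_lin S0 cvg_S).
have raw0 : cvgC (fun n => phi (T n ^+ m) / sqrtC n%:R ^+ m) 0.
  by apply: odd_moment_cvg0 => //; [exact: phi_bound | exact: (phi_singleton condA)].
have /eqP := cvgC_unique (phi_raw_cvg m) raw0.
rewrite fmorph_eq0 mulf_eq0 expf_eq0 (gt_eqF S0) andbF /= => /eqP ->.
exact: (normalized_of_raw0 phi_lin S0 cvg_S raw0).
Qed.

End MomentLimits.

(** * Integrals of bounded functions *)

Section BoundedIntegral.
Context d (T : measurableType d) (R : realType).
Variables (mu : {measure set T -> \bar R}) (D : set T).
Hypotheses (mD : measurable D) (muD : mu D = 1%E).
Implicit Types (f g : T -> R).

(** Boundedness is required only on [D]: powers of [x] qualify on a ball, and the class is closed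
    under sums and products. *)
Definition bounded_measurable f :=
  measurable_fun D f /\ exists B : R, forall x, D x -> `|f x| <= B.

Lemma bounded_measurable_integrable f :
  bounded_measurable f -> mu.-integrable D (EFin \o f).
Proof.
move=> [mf [B fB]]; apply: measurable_bounded_integrable => //.
  by rewrite muD ltry.
by exists B; split=> [|M BM x Dx /=]; rewrite ?num_real// (le_trans (fB _ Dx))// ltW.
Qed.

Lemma bounded_measurable_cst (c : R) : bounded_measurable (fun=> c).
Proof. by split; [exact: measurable_cst | exists `|c|]. Qed.

Lemma bounded_measurableD f g : bounded_measurable f -> bounded_measurable g ->
  bounded_measurable (fun x => f x + g x).
Proof.
move=> [mf [B fB]] [mg [C gC]]; split; first exact: measurable_funD.
exists (B + C) => x Dx.
by rewrite (le_trans (ler_normD _ _))// lerD ?fB ?gC.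
Qed.

Lemma bounded_measurableM f g : bounded_measurable f -> bounded_measurable g ->
  bounded_measurable (fun x => f x * g x).
Proof.
move=> [mf [B fB]] [mg [C gC]]; split; first exact: measurable_funM.
by exists (B * C) => x Dx; rewrite normrM ler_pM ?fB ?gC.
Qed.

Lemma bounded_measurableX f m : bounded_measurable f ->
  bounded_measurable (fun x => f x ^+ m).
Proof.
move=> bf; elim: m => [|m IH].
  by under eq_fun do rewrite expr0; exact: bounded_measurable_cst.
by under eq_fun do rewrite exprS; exact: bounded_measurableM.
Qed.

Lemma bounded_measurable_sum (I : Type) (r : seq I) (F : I -> T -> R) :
  (forall i, bounded_measurable (F i)) ->
  bounded_measurable (fun x => \sum_(i <- r) F i x).
Proof.
move=> bF; elim: r => [|i r IH].
  by under eq_fun do rewrite big_nil; exact: bounded_measurable_cst.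
by under eq_fun do rewrite big_cons; exact: bounded_measurableD.
Qed.

Lemma bounded_measurable_horner (p : {poly R}) f : bounded_measurable f ->
  bounded_measurable (fun x => p.[f x]).
Proof.
move=> bf; under eq_fun do rewrite horner_coef.
apply: bounded_measurable_sum => i; apply: bounded_measurableM.
  exact: bounded_measurable_cst.
exact: bounded_measurableX.
Qed.

Lemma bRintegral_cst (c : R) : \int[mu]_(x in D) c = c.
Proof. by rewrite Rintegral_cst// muD mulr1. Qed.

Lemma bRintegralD f g : bounded_measurable f -> bounded_measurable g ->
  \int[mu]_(x in D) (f x + g x) = \int[mu]_(x in D) f x + \int[mu]_(x in D) g x.
Proof.
by move=> bf bg; rewrite RintegralD//; exact: bounded_measurable_integrable.
Qed.

Lemma bRintegralZ c f : bounded_measurable f ->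
  \int[mu]_(x in D) (c * f x) = c * \int[mu]_(x in D) f x.
Proof.
by move=> bf; rewrite RintegralZl//; exact: bounded_measurable_integrable.
Qed.

Lemma bRintegral_sum (I : Type) (r : seq I) (F : I -> T -> R) :
  (forall i, bounded_measurable (F i)) ->
  \int[mu]_(x in D) (\sum_(i <- r) F i x) = \sum_(i <- r) \int[mu]_(x in D) F i x.
Proof.
move=> bF; elim: r => [|i r IH].
  rewrite big_nil; under eq_Rintegral do rewrite big_nil.
  exact: bRintegral_cst.
rewrite big_cons -IH -bRintegralD//; last exact: bounded_measurable_sum.
by apply: eq_Rintegral => x _; rewrite big_cons.
Qed.

Lemma ler_bRintegral f g : bounded_measurable f -> bounded_measurable g ->
  (forall x, D x -> f x <= g x) ->
  \int[mu]_(x in D) f x <= \int[mu]_(x in D) g x.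
Proof.
by move=> bf bg fg; apply: le_Rintegral => //; exact: bounded_measurable_integrable.
Qed.

Lemma bRintegral_bound f (B : R) : bounded_measurable f ->
  (forall x, D x -> `|f x| <= B) -> `|\int[mu]_(x in D) f x| <= B.
Proof.
move=> bf fB; rewrite ler_norml; apply/andP; split.
  rewrite -[leLHS](bRintegral_cst (- B)).
  apply: ler_bRintegral => //; first exact: bounded_measurable_cst.
  by move=> x Dx; rewrite lerNl (le_trans _ (fB x Dx))// -normrN ler_norm.
rewrite -[leRHS](bRintegral_cst B).
apply: ler_bRintegral => //; first exact: bounded_measurable_cst.
by move=> x Dx; rewrite (le_trans (ler_norm _) (fB x Dx)).
Qed.

Lemma bRintegral_horner (p : {poly R}) f : bounded_measurable f ->
  \int[mu]_(x in D) p.[f x] =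
  polyfun (fun k => \int[mu]_(x in D) (f x ^+ k)) p.
Proof.
move=> bf; under eq_Rintegral do rewrite horner_coef.
rewrite bRintegral_sum => [|i].
  by apply: eq_bigr => i _; rewrite bRintegralZ//; exact: bounded_measurableX.
apply: bounded_measurableM; first exact: bounded_measurable_cst.
exact: bounded_measurableX.
Qed.

End BoundedIntegral.

(** * Restriction of integrals to the support *)

Section CompactSupport.
Variables (R : realType) (mu : probability R R) (M : R).
Hypothesis mu0 : mu [set x : R | M < `|x|] = 0%E.

Definition centered_ball : set R := [set x | `|x| <= M].

Lemma measurable_centered_ball : measurable centered_ball.
Proof.
have -> : centered_ball = `[- M, M]%classic.
  by apply/seteqP; split=> x; rewrite /centered_ball /= in_itv /= ler_norml.
exact: measurable_itv.
Qed.

Lemma setC_centered_ball : ~` centered_ball = [set x : R | M < `|x|].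
Proof. by apply/seteqP; split=> x; rewrite /centered_ball /= ltNge => /negP. Qed.

Lemma centered_ball_mass : mu centered_ball = 1%E.
Proof.
have := probability_setC mu measurable_centered_ball.
rewrite setC_centered_ball mu0 => /esym/eqP.
by rewrite sube_eq// ?add0e ?fin_num_measure// => /eqP <-.
Qed.

(** The complement of the ball is null, which reduces integrals over the line to those of bounded
    functions. *)
Lemma Rintegral_centered_ball (f : R -> R) :
  bounded_measurable centered_ball f ->  measurable_fun setT f ->
  \int[mu]_x f x = \int[mu]_(x in centered_ball) f x.
Proof.
move=> bf mf; rewrite /Rintegral; congr fine.
have mC := measurable_centered_ball; have mN := measurableC mC.
have N0 : mu (~` centered_ball) = 0%E by rewrite setC_centered_ball.
have intf : mu.-integrable setT (EFin \o f).
  apply/(negligible_integrable mN measurableT _ N0); first exact/measurable_EFinP.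
  rewrite setTD setCK.
  exact: bounded_measurable_integrable mC centered_ball_mass _ bf.
by rewrite (negligible_integral mN measurableT intf N0) setTD setCK.
Qed.

End CompactSupport.

(** * The Hausdorff moment problem *)

(** The factorial moments of the binomial distribution, that is [x^m] times the [m]-th derivative of
    the binomial formula. The induction rests on [(k + 1) C(n + 1, k + 1) = (n + 1) C(n, k)]. *)
Lemma bernstein_ffact_poly (F : comNzRingType) (x y : F) n m :
  \sum_(k < n.+1) (x ^+ k * y ^+ (n - k)) *+ ('C(n, k) * k ^_ m) =
  (x ^+ m * (x + y) ^+ (n - m)) *+ n ^_ m.
Proof.
elim: m n => [|m IH] n.
  rewrite ffactn0 mulr1n mul1r subn0 addrC exprDn; apply: eq_bigr => k _.
  by rewrite ffactn0 muln1 mulrC.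
rewrite big_ord_recl ffact0n muln0 mulr0n add0r.
case: n => [|n]; first by rewrite big_ord0 ffact0n mulr0n.
rewrite ffactSS mulnC mulrnA subSS exprS -!mulrA -[in RHS]mulrnAr -IH mulr_sumr -sumrMnl.
apply: eq_bigr => k _; rewrite /bump /= ?add1n subSS ffactSS exprS.
by rewrite mulnA [('C(_, _) * _)%N]mulnC -mul_bin_diag /= -mulnA mulnC mulrnA -mulrA mulrnAr.
Qed.

Lemma ffact_le_exp k m : (k ^_ m <= k ^ m)%N.
Proof. by elim: m => // m IH; rewrite ffactnSr expnSr leq_mul// leq_subr. Qed.

(** Multiplied by [n] to stay in the integers: replacing a power by a falling factorial costs at
    most [m^2 / n] relative to [n^m]. *)
Lemma expn_le_ffact n k m : (k <= n)%N ->
  (n * k ^ m <= n * k ^_ m + m ^ 2 * n ^ m)%N.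
Proof.
move=> kn; elim: m => [|m IH]; first by rewrite expn0 ffactn0 leq_addr.
rewrite ffactnSr expnSr mulnA.
apply: (@leq_trans ((n * k ^_ m + m ^ 2 * n ^ m) * k)).
  by rewrite leq_mul2r IH orbT.
have H1 : (m ^ 2 * n ^ m * k <= m ^ 2 * n ^ m.+1)%N.
  by rewrite [(n ^ m.+1)%N]expnSr mulnA leq_mul.
have H2 : (n * (k ^_ m * m) <= n * n ^ m * m)%N.
  rewrite mulnA leq_mul// leq_mul// (leq_trans (ffact_le_exp _ _))//.
  by case: (m) => [|p]; rewrite ?expn0 ?leq_exp2r.
have H3 : (n * k ^_ m * k <= n * (k ^_ m * (k - m)) + n * (k ^_ m * m))%N.
  by rewrite -mulnDr -mulnDr -mulnA !leq_mul//; lia.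
rewrite -expnS in H2.
have -> : (m.+1 ^ 2 * n ^ m.+1 = m ^ 2 * n ^ m.+1 + n ^ m.+1 * m + m.+1 * n ^ m.+1)%N.
  by ring.
lia.
Qed.

Section BernsteinWeights.
Variables (R : realType) (l : nat -> R).
Hypothesis l0 : l 0%N = 1.
Hypothesis l_ge0 : forall i j, 0 <= polyfun l ('X ^+ i * (1 - 'X) ^+ j).

(** The integral of a Bernstein basis polynomial against the measure sought, serving as the mass at
    [k / n] of a discrete approximation. *)
Definition bernstein_weight n k : R :=
  polyfun l ('X ^+ k * (1 - 'X) ^+ (n - k)) *+ 'C(n, k).

Lemma bernstein_weight_ge0 n k : 0 <= bernstein_weight n k.
Proof. by rewrite mulrn_wge0. Qed.

Lemma bernstein_weight_ffact n m :
  \sum_(k < n.+1) bernstein_weight n k * (k ^_ m)%:R = l m * (n ^_ m)%:R.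
Proof.
have := bernstein_ffact_poly 'X (1 - 'X : {poly R}) n m.
have -> : 'X + (1 - 'X) = 1 :> {poly R} by rewrite addrC subrK.
rewrite expr1n mulr1 => /(congr1 (polyfun l)).
rewrite linear_sum linearMn /= polyfunXn mulr_natr => <-.
by apply: eq_bigr => k _; rewrite linearMn mulrnA mulr_natr.
Qed.

Lemma bernstein_weight_sum n : \sum_(k < n.+1) bernstein_weight n k = 1.
Proof.
have := bernstein_weight_ffact n 0; rewrite ffactn0 l0 mulr1 => <-.
by apply: eq_bigr => k _; rewrite mulr1.
Qed.

(** The factorial moments are exact; the error comes from replacing falling factorials by powers
    twice, for [k] and for [n]. *)
Lemma bernstein_moment n m : (0 < n)%N ->
  `|\sum_(k < n.+1) bernstein_weight n k * (k%:R / n%:R) ^+ m - l m| <=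
  (m ^ 2)%:R * (1 + `|l m|) / n%:R.
Proof.
move=> n0; have nr : 0 < n%:R :> R by rewrite ltr0n.
have E k : (k <= n)%N -> `|n%:R * k%:R ^+ m - n%:R * (k ^_ m)%:R| <=
    (m ^ 2)%:R * n%:R ^+ m :> R.
  move=> kn; rewrite -!natrX -!natrM ger0_norm.
    by rewrite lerBlDl -natrD ler_nat expn_le_ffact.
  by rewrite subr_ge0 ler_nat leq_mul2l ffact_le_exp orbT.
rewrite -(ler_pM2r (exprn_gt0 m.+1 nr)) -[X in _ * X <= _]gtr0_norm ?exprn_gt0//.
rewrite -normrM.
have -> : (\sum_(k < n.+1) bernstein_weight n k * (k%:R / n%:R) ^+ m - l m) * n%:R ^+ m.+1
  = \sum_(k < n.+1) bernstein_weight n k * (n%:R * k%:R ^+ m - n%:R * (k ^_ m)%:R)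
    - l m * (n%:R * n%:R ^+ m - n%:R * (n ^_ m)%:R).
  have -> : \sum_(k < n.+1) bernstein_weight n k * (n%:R * k%:R ^+ m - n%:R * (k ^_ m)%:R) =
     n%:R * (\sum_(k < n.+1) bernstein_weight n k * k%:R ^+ m - l m * (n ^_ m)%:R).
    rewrite -bernstein_weight_ffact -sumrB mulr_sumr; apply: eq_bigr => k _.
    by ring.
  have -> : \sum_(k < n.+1) bernstein_weight n k * (k%:R / n%:R) ^+ m =
     (\sum_(k < n.+1) bernstein_weight n k * k%:R ^+ m) / n%:R ^+ m.
    by rewrite mulr_suml; apply: eq_bigr => k _; rewrite expr_div_n mulrA.
  by rewrite exprS; field; rewrite expf_neq0 ?gt_eqF// lt0r_neq0.
have -> : (m ^ 2)%:R * (1 + `|l m|) / n%:R * n%:R ^+ m.+1 =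
    (m ^ 2)%:R * n%:R ^+ m + `|l m| * ((m ^ 2)%:R * n%:R ^+ m) :> R.
  by rewrite exprS; field; rewrite gt_eqF.
rewrite (le_trans (ler_normB _ _))// lerD// ?normrM ?ler_wpM2l ?E//.
rewrite (le_trans (ler_norm_sum _ _ _))//.
rewrite -[leRHS]mul1r -[X in _ <= X * _](bernstein_weight_sum n) mulr_suml; apply: ler_sum => k _.
rewrite normrM (ger0_norm (bernstein_weight_ge0 _ _)).
by apply: ler_wpM2l; [exact: bernstein_weight_ge0 | apply: E; rewrite -ltnS].
Qed.

Definition bernstein_cumul n k : R := \sum_(i < k.+1) bernstein_weight n i.

Lemma bernstein_cumul_le n i j : (i <= j)%N ->
  bernstein_cumul n i <= bernstein_cumul n j.
Proof.
move=> /subnKC <-; elim: (j - i)%N => [|k IH]; first by rewrite addn0.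
rewrite addnS (le_trans IH)// /bernstein_cumul [leRHS]big_ord_recr lerDl.
exact: bernstein_weight_ge0.
Qed.

Lemma bernstein_cumul_ge0 n k : 0 <= bernstein_cumul n k.
Proof. by rewrite sumr_ge0// => i _; exact: bernstein_weight_ge0. Qed.

Lemma bernstein_cumul_le1 n k : (k <= n)%N -> bernstein_cumul n k <= 1.
Proof. by move/(bernstein_cumul_le n); rewrite {2}/bernstein_cumul bernstein_weight_sum. Qed.

End BernsteinWeights.

(** * Step functions and Riemann sums *)

Section StepFunctions.
Variable R : realType.
Implicit Types (b : nat -> bool) (g w : nat -> R) (f : R -> R).

Lemma prefix_count b n : (forall k, b k.+1 -> b k) ->
  let c := (\sum_(k < n) b k)%N in
  [/\ (c <= n)%N, forall k, (k < c)%N -> b k & (c < n)%N -> ~~ b c].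
Proof.
move=> bS; have bW i j : (i <= j)%N -> b j -> b i.
  by move=> /subnKC <-; elim: (j - i)%N => [|k IH]; rewrite ?addn0// addnS => /bS.
elim: n => [|n [IH1 IH2 IH3]] c; first by rewrite /c big_ord0; split.
rewrite /c big_ord_recr /=; case: (boolP (b n)) => bn /=.
  have -> : (\sum_(i < n) b i)%N = n.
    apply/eqP; rewrite eqn_leq IH1 leqNgt; apply/negP => /[dup] cn /IH3.
    by rewrite (bW _ _ _ bn)// ltnW.
  rewrite addn1; split => // [k|]; last by rewrite ltnn.
  by rewrite ltnS => /bW; apply.
rewrite addn0; split => //; first exact: ltnW.
move: IH1; rewrite leq_eqVlt => /orP[/eqP -> //|/IH3 //].
Qed.

(** Telescoping along the initial run of [true] values. It turns a function of a step count into a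
    combination of indicators, which is integrated term by term. *)
Lemma prefix_sum b n g : (forall k, b k.+1 -> b k) ->
  g (\sum_(k < n) b k)%N =
  g 0%N + \sum_(k < n) (b k)%:R * (g k.+1 - g k).
Proof.
move=> bS; elim: n => [|n IH]; first by rewrite !big_ord0 addr0.
rewrite !big_ord_recr /= addrA -IH; case: (boolP (b n)) => bn.
  have [c1 _ c2] := prefix_count n bS.
  have -> : (\sum_(i < n) b i)%N = n.
    apply/eqP; rewrite eqn_leq c1 leqNgt; apply/negP => /[dup] cn /c2.
    have bW i j : (i <= j)%N -> b j -> b i.
      by move=> /subnKC <-; elim: (j - i)%N => [|k IHk]; rewrite ?addn0// addnS => /bS.
    by rewrite (bW _ _ _ bn)// ltnW.
  by rewrite addn1 mul1r addrC subrK.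
by rewrite addn0 mul0r addr0.
Qed.

Lemma abel_sum w g n :
  \sum_(k < n.+1) w k * g k = (\sum_(i < n.+1) w i) * g n -
  \sum_(k < n) (\sum_(i < k.+1) w i) * (g k.+1 - g k).
Proof.
elim: n => [|n IH]; first by rewrite !big_ord_recl !big_ord0 subr0 !addr0.
rewrite big_ord_recr /= IH [in RHS]big_ord_recr [X in _ = _ - X]big_ord_recr /=.
by ring.
Qed.

Lemma Rintegral_lt_step (c : R) : 0 <= c <= 1 ->
  \int[lebesgue_measure]_(u in `[0, 1]) (c < u)%R%:R = 1 - c :> R.
Proof.
move=> /andP[c0 c1]; rewrite /Rintegral.
transitivity (fine (\int[@lebesgue_measure R]_(u in `[0, 1]) (\1_`]c, +oo[ u)%:E)).
  by congr fine; apply: eq_integral => u _; rewrite indicE mem_setE in_itv /= andbT.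
rewrite integral_indic//=.
have -> : `]c, +oo[ `&` `[0, 1] = `]c, 1]%classic :> set R.
  apply/seteqP; split=> u /=; rewrite !in_itv /= andbT.
    by case=> -> /andP[_ ->].
  by move=> /andP[cu ->]; rewrite cu (le_trans c0 (ltW cu)).
rewrite lebesgue_measure_itv /= lte_fin; case: ltgtP c1 => // -> _ /=.
by rewrite subrr.
Qed.

Lemma Rintegral_le_step (c : R) : 0 <= c <= 1 ->
  \int[lebesgue_measure]_(u in `[0, 1]) (c <= u)%R%:R = 1 - c :> R.
Proof.
move=> /andP[c0 c1]; rewrite /Rintegral.
transitivity (fine (\int[@lebesgue_measure R]_(u in `[0, 1]) (\1_`[c, +oo[ u)%:E)).
  by congr fine; apply: eq_integral => u _; rewrite indicE mem_setE in_itv /= andbT.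
rewrite integral_indic//=.
have -> : `[c, +oo[ `&` `[0, 1] = `[c, 1]%classic :> set R.
  apply/seteqP; split=> u /=; rewrite !in_itv /= andbT.
    by case=> -> /andP[_ ->].
  by move=> /andP[cu ->]; rewrite cu (le_trans c0 cu).
rewrite lebesgue_measure_itv /= lte_fin; case: ltgtP c1 => // -> _ /=.
by rewrite subrr.
Qed.

End StepFunctions.

Section RiemannSums.
Variable R : realType.
Implicit Types (c : R) (f : R -> R).

Local Notation I01 := (`[0, 1]%classic : set R).

Lemma lebesgue_measure01 : lebesgue_measure I01 = 1%E :> \bar R.
Proof. by rewrite lebesgue_measure_itv /= lte_fin ltr01 oppr0 addr0. Qed.

Let m01 : measurable I01. Proof. exact: measurable_itv. Qed.

Let bRD := @bRintegralD _ _ _ (@lebesgue_measure R) _ m01 lebesgue_measure01.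
Let bRZ := @bRintegralZ _ _ _ (@lebesgue_measure R) _ m01 lebesgue_measure01.
Let bRcst := @bRintegral_cst _ _ _ (@lebesgue_measure R) _ m01 lebesgue_measure01.
Let bRsum := @bRintegral_sum _ _ _ (@lebesgue_measure R) _ m01 lebesgue_measure01.
Let bRle := @ler_bRintegral _ _ _ (@lebesgue_measure R) _ m01 lebesgue_measure01.

Lemma bounded_measurable_monotone (D : set R) f : measurable D ->
  {homo f : x y / x <= y} -> (forall x, 0 <= f x <= 1) -> bounded_measurable D f.
Proof.
move=> mD f_nd f01; split; first exact: nondecreasing_measurable.
by exists 1 => x _; have /andP[f0 f1] := f01 x; rewrite ger0_norm.
Qed.

Lemma bounded_measurable_lt (D : set R) c : measurable D ->
  bounded_measurable D (fun u : R => (c < u)%R%:R : R).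
Proof.
move=> mD; apply: bounded_measurable_monotone => // [x y xy|x].
  by rewrite ler_nat; case: (ltP c x) => // cx; rewrite (lt_le_trans cx xy).
by case: (c < x); rewrite ?lexx ler01.
Qed.

Lemma bounded_measurable_le (D : set R) c : measurable D ->
  bounded_measurable D (fun u : R => (c <= u)%R%:R : R).
Proof.
move=> mD; apply: bounded_measurable_monotone => // [x y xy|x].
  by rewrite ler_nat; case: (leP c x) => // cx; rewrite (le_trans cx xy).
by case: (c <= x); rewrite ?lexx ler01.
Qed.

Lemma Rintegral_lt_steps (g0 : R) (c d : nat -> R) n :
  (forall k, (k < n)%N -> 0 <= c k <= 1) ->
  \int[lebesgue_measure]_(u in I01) (g0 + \sum_(k < n) (c k < u)%R%:R * d k) =
  g0 + \sum_(k < n) (1 - c k) * d k.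
Proof.
move=> c01; have bs k : bounded_measurable I01 (fun u : R => (c k < u)%R%:R * d k : R).
  apply: bounded_measurableM; first exact: bounded_measurable_lt.
  exact: bounded_measurable_cst.
rewrite bRD; last 2 first.
- exact: bounded_measurable_cst.
- by apply: bounded_measurable_sum => k; exact: bs.
rewrite bRcst; congr (_ + _).
rewrite bRsum; last exact: bs.
apply: eq_bigr => k _.
under eq_Rintegral do rewrite mulrC.
rewrite bRZ; last exact: bounded_measurable_lt.
by rewrite Rintegral_lt_step ?c01// mulrC.
Qed.

Lemma Rintegral_le_steps (g0 : R) (c d : nat -> R) n :
  (forall k, (k < n)%N -> 0 <= c k <= 1) ->
  \int[lebesgue_measure]_(u in I01) (g0 + \sum_(k < n) (c k <= u)%R%:R * d k) =
  g0 + \sum_(k < n) (1 - c k) * d k.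
Proof.
move=> c01; have bs k : bounded_measurable I01 (fun u : R => (c k <= u)%R%:R * d k : R).
  apply: bounded_measurableM; first exact: bounded_measurable_le.
  exact: bounded_measurable_cst.
rewrite bRD; last 2 first.
- exact: bounded_measurable_cst.
- by apply: bounded_measurable_sum => k; exact: bs.
rewrite bRcst; congr (_ + _).
rewrite bRsum; last exact: bs.
apply: eq_bigr => k _.
under eq_Rintegral do rewrite mulrC.
rewrite bRZ; last exact: bounded_measurable_le.
by rewrite Rintegral_le_step ?c01// mulrC.
Qed.

Lemma riemann_sum_abel (f : nat -> R) n (N : R) :
  N * f 0%N + \sum_(j < n) (N - j.+1%:R) * (f j.+1 - f j) =
  \sum_(j < n) f j + (N - n%:R) * f n.
Proof.
elim: n => [|n IH]; first by rewrite !big_ord0 add0r addr0 subr0.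
by rewrite !big_ord_recr /= addrA IH -natr1; ring.
Qed.

(** On the grid [j / N] the function lies between two step functions whose integrals differ by
    [(f 1 - f 0) / N], and the lower one integrates to the left Riemann sum. The error bound is the
    same for all [f], as the passage to the limit requires. *)
Lemma riemann_sum_monotone f N : (0 < N)%N -> {homo f : x y / x <= y} ->
  (forall x, 0 <= f x <= 1) ->
  `|\int[lebesgue_measure]_(u in I01) f u -
    (\sum_(j < N) f (j%:R / N%:R)) / N%:R| <= N%:R^-1.
Proof.
move=> N0 f_nd f01.
have Nr : 0 < N%:R :> R by rewrite ltr0n.
pose g j := f (j%:R / N%:R); pose d j := g j.+1 - g j.
have d0 j : 0 <= d j.
  by rewrite subr_ge0 f_nd// ler_wpM2r ?invr_ge0 ?ler0n// ler_nat.
have bf : bounded_measurable I01 f by exact: bounded_measurable_monotone.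
have frac j : (j <= N)%N -> 0 <= (j%:R / N%:R : R) <= 1.
  by move=> jN; rewrite divr_ge0//= ler_pdivrMr// mul1r ler_nat.
have lo : g 0%N + \sum_(j < N) (1 - j.+1%:R / N%:R) * d j <=
    \int[lebesgue_measure]_(u in I01) f u.
  rewrite -(@Rintegral_le_steps _ (fun j => j.+1%:R / N%:R)); last first.
    by move=> k kN; exact: frac.
  apply: bRle => //.
    apply: bounded_measurableD; first exact: bounded_measurable_cst.
    apply: bounded_measurable_sum => k; apply: bounded_measurableM.
      exact: bounded_measurable_le.
    exact: bounded_measurable_cst.
  move=> u /=; rewrite in_itv /= => /andP[u0 u1].
  pose b j := j.+1%:R / N%:R <= u.
  have bS k : b k.+1 -> b k.
    by apply: le_trans; rewrite ler_wpM2r ?invr_ge0 ?ler0n// ler_nat.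
  rewrite [leLHS](_ : _ = g (\sum_(k < N) b k)%N); last by rewrite (prefix_sum N g bS).
  have [_ + _] := prefix_count N bS.
  case: (\sum_(k < N) b k)%N => [_|c /(_ c (ltnSn _)) bc]; apply: f_nd => //.
  by rewrite mul0r.
have hi : \int[lebesgue_measure]_(u in I01) f u <=
    g 0%N + \sum_(j < N) (1 - j%:R / N%:R) * d j.
  rewrite -(@Rintegral_lt_steps _ (fun j => j%:R / N%:R)); last first.
    by move=> k /ltnW kN; exact: frac.
  apply: bRle => //.
    apply: bounded_measurableD; first exact: bounded_measurable_cst.
    apply: bounded_measurable_sum => k; apply: bounded_measurableM.
      exact: bounded_measurable_lt.
    exact: bounded_measurable_cst.
  move=> u /=; rewrite in_itv /= => /andP[u0 u1].
  pose b j := j%:R / N%:R < u.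
  have bS k : b k.+1 -> b k.
    by apply: le_lt_trans; rewrite ler_wpM2r ?invr_ge0 ?ler0n// ler_nat.
  rewrite [leRHS](_ : _ = g (\sum_(k < N) b k)%N); last by rewrite (prefix_sum N g bS).
  have [cN _ cb] := prefix_count N bS.
  apply: f_nd; move: cN; rewrite leq_eqVlt => /orP[/eqP ->|/cb].
    by rewrite divff// gt_eqF.
  by rewrite -leNgt.
have := riemann_sum_abel g N N%:R; rewrite subrr mul0r addr0 => abel.
have E : g 0%N + \sum_(j < N) (1 - j.+1%:R / N%:R) * d j = (\sum_(j < N) g j) / N%:R.
  rewrite -abel mulrDl mulrC mulKf ?gt_eqF// mulr_suml; congr (_ + _).
  by apply: eq_bigr => j _; rewrite -/(d j); field; rewrite gt_eqF.
have E2 : \sum_(j < N) (1 - j%:R / N%:R) * d j =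
    \sum_(j < N) (1 - j.+1%:R / N%:R) * d j + (g N - g 0%N) / N%:R.
  have -> : g N - g 0%N = \sum_(j < N) d j.
    by rewrite -(big_mkord xpredT d) telescope_sumr.
  rewrite mulr_suml -big_split; apply: eq_bigr => j _.
  by rewrite -natr1 /=; field; rewrite gt_eqF.
rewrite E in lo; rewrite E2 addrA E in hi.
have g1 : (g N - g 0%N) / N%:R <= N%:R^-1.
  rewrite ler_piMl ?invr_ge0 ?ler0n// lerBlDr.
  have /andP[_ /le_trans->//] := f01 (N%:R / N%:R).
  by have /andP[h _] := f01 (0%:R / N%:R); rewrite lerDl.
rewrite ger0_norm ?subr_ge0// lerBlDl (le_trans hi)//.
by rewrite lerD2l.
Qed.

End RiemannSums.

Lemma image_ultrafilter (T U : Type) (G : set_system T) (f : T -> U) :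
  UltraFilter G -> UltraFilter (f @ G).
Proof.
move=> GU; apply: Build_UltraFilter => H HF sub; apply/seteqP; split=> [A HA|A /sub//].
have [//|GnA] := in_ultra_setVsetC (f @^-1` A) GU.
have HnA : H (~` A) by apply: sub.
by have [x []] := @filter_ex _ _ HF _ (filterI HA HnA).
Qed.

(** * A limit of quantile functions with the prescribed moments *)

Section QuantileLimit.
Variables (R : realType) (l : nat -> R).
Hypothesis l0 : l 0%N = 1.
Hypothesis l_ge0 : forall i j, 0 <= polyfun l ('X ^+ i * (1 - 'X) ^+ j).

Local Notation I01 := (`[0, 1]%classic : set R).

(* The quantile function of the measure with mass [bernstein_weight l n k] at
   the point [k / n]. *)
Definition quantile n (u : R) : R :=
  (\sum_(k < n) (bernstein_cumul l n k < u)%R)%N%:R / n%:R.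

Lemma quantile01 n u : 0 <= quantile n u <= 1.
Proof.
rewrite /quantile divr_ge0//=; case: n => [|n]; first by rewrite big_ord0 mul0r.
rewrite ler_pdivrMr ?ltr0n// mul1r ler_nat.
rewrite -[leqRHS]muln1 -[X in (X * 1)%N]card_ord -sum_nat_const.
by apply: leq_sum => k _; exact: leq_b1.
Qed.

Lemma quantile_nd n : {homo quantile n : x y / x <= y}.
Proof.
move=> x y xy; rewrite ler_wpM2r ?invr_ge0// ler_nat; apply: leq_sum => k _.
by case: (ltP _ x) => // /lt_le_trans ->.
Qed.

(** The indicator of [bernstein_cumul l n k < u] integrates to one minus the cumulative weight;
    summation by parts then restores the weights. *)
Lemma quantile_moment n m :
  \int[lebesgue_measure]_(u in I01) (quantile n u ^+ m) =
  \sum_(k < n.+1) bernstein_weight l n k * (k%:R / n%:R) ^+ m.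
Proof.
pose g k : R := (k%:R / n%:R) ^+ m.
have bS u k : bernstein_cumul l n k.+1 < u -> bernstein_cumul l n k < u.
  by apply: le_lt_trans; exact: bernstein_cumul_le.
transitivity (\int[lebesgue_measure]_(u in I01) (g 0%N +
    \sum_(k < n) (bernstein_cumul l n k < u)%R%:R * (g k.+1 - g k))).
  apply: eq_Rintegral => u _.
  exact: (prefix_sum n g (bS u)).
rewrite (@Rintegral_lt_steps _ _ (bernstein_cumul l n) (fun k => g k.+1 - g k));
  last by move=> k /ltnW kn; rewrite bernstein_cumul_ge0//= bernstein_cumul_le1.
rewrite (abel_sum _ g) bernstein_weight_sum// mul1r.
under eq_bigr do rewrite mulrBl mul1r.
rewrite sumrB addrA; congr (_ - _).
by rewrite -(big_mkord xpredT (fun k => g k.+1 - g k)) telescope_sumr// addrC subrK.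
Qed.

(** Compactness of [[0, 1]] gives a limit along one ultrafilter at every [u] simultaneously, and
    monotonicity is inherited. Moments pass to the limit because Riemann sums with a number of nodes
    fixed in advance approximate the integrals uniformly in [n]. *)
Lemma quantile_limit : exists Q : R -> R,
  [/\ {homo Q : x y / x <= y}, forall u, 0 <= Q u <= 1 &
      forall m, \int[lebesgue_measure]_(u in I01) (Q u ^+ m) = l m].
Proof.
have [G [GU Ginf]] := ultraFilterLemma (@eventually_filter).
have Qex u : exists q : R, 0 <= q <= 1 /\ (quantile^~ u @ G --> q).
  have := @segment_compact R 0 1; rewrite compact_ultra /=.
  move=> /(_ (quantile^~ u @ G) (image_ultrafilter _ GU)) [|q [q01 qG]].
    by apply: (@filterE _ G) => n /=; rewrite in_itv /=; exact: quantile01.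
  by exists q; split => //; move: q01; rewrite /= in_itv.
have [Q HQ] := choice Qex; exists Q.
have Q01 u : 0 <= Q u <= 1 := (HQ u).1.
have QG u : quantile^~ u @ G --> Q u := (HQ u).2.
have Qnd : {homo Q : x y / x <= y}.
  move=> x y xy; apply: (ler_cvg_to (QG x) (QG y)).
  by apply: filterS filterT => n _; exact: quantile_nd.
split=> // m.
have pow_nd (f : R -> R) : {homo f : x y / x <= y} -> (forall u, 0 <= f u <= 1) ->
    {homo (fun u => f u ^+ m) : x y / x <= y}.
  move=> fnd f01 x y xy; have /andP[fx0 _] := f01 x; have /andP[fy0 _] := f01 y.
  by rewrite lerXn2r// ?nnegrE// fnd.
have pow01 (f : R -> R) : (forall u, 0 <= f u <= 1) ->
    forall u, 0 <= f u ^+ m <= 1.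
  by move=> f01 u; have /andP[f0 f1] := f01 u; rewrite exprn_ge0//= exprn_ile1.
apply/eqP; rewrite -subr_eq0 -normr_le0; apply/ler_addgt0Pr => e e0; rewrite add0r.
(* Four errors are to be controlled: the Riemann sum of the limit, the convergence at its [N] nodes,
   the Riemann sum of the [n]-th quantile function, and the Bernstein moment. *)
have e40 : 0 < e / 4 by rewrite divr_gt0.
pose N := (Num.truncn (e / 4)^-1).+1.
have Ne : (N%:R)^-1 <= e / 4.
  by rewrite invf_ple ?posrE ?ltr0n// ltW// truncnS_gt.
pose RS (f : R -> R) := (\sum_(j < N) f (j%:R / N%:R)) / N%:R.
have RSG : RS (fun u => quantile n u ^+ m) @[n --> G] --> RS (fun u => Q u ^+ m).
  apply: cvgM; last exact: cvg_cst.
  apply: cvg_big => [|j _]; first exact: add_continuous.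
  exact: (continuous_cvg _ (@exprn_continuous _ m _) (QG _)).
have near1 : \forall n \near G, `|RS (fun u => Q u ^+ m) - RS (fun u => quantile n u ^+ m)| < e / 4.
  by move/cvgrPdist_lt : RSG; apply.
pose C := (m ^ 2)%:R * (1 + `|l m|) : R.
have near2 : \forall n \near G, C / n%:R <= e / 4.
  apply: Ginf; exists (Num.truncn (C / (e / 4))).+1 => // n /= nC.
  have n0 : (0 < n)%N by rewrite (leq_trans _ nC).
  rewrite ler_pdivrMr ?ltr0n// mulrC -ler_pdivrMr// ltW//.
  by rewrite (lt_le_trans (truncnS_gt _))// ler_nat.
have near3 : \forall n \near G, (0 < n)%N by apply: Ginf; exists 1%N.
have [n [[n1 n2] n0]] := filter_ex (filterI (filterI near1 near2) near3).
have r1 := riemann_sum_monotone (ltn0Sn _ : 0 < N)%N (pow_nd _ Qnd Q01) (pow01 _ Q01).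
have r2 := riemann_sum_monotone (ltn0Sn _ : 0 < N)%N (pow_nd _ (@quantile_nd n) (quantile01 n))
  (pow01 _ (quantile01 n)).
have r3 := bernstein_moment l0 l_ge0 m n0.
rewrite -/(RS (fun u => Q u ^+ m)) in r1.
rewrite -/(RS (fun u => quantile n u ^+ m)) quantile_moment in r2.
set a := Rintegral _ _ _ in r1 *; set b := RS _ in r1 n1; set c := RS _ in r2 n1.
set d := \sum_(k < n.+1) _ in r2 r3.
have -> : a - l m = (a - b) + (b - c) + (c - d) + (d - l m) by ring.
rewrite (le_trans (ler_normD _ _))// (_ : e = e / 4 * 3 + e / 4); last by field.
rewrite lerD//; last exact: le_trans r3 n2.
rewrite (le_trans (ler_normD _ _))// (_ : e / 4 * 3 = e / 4 * 2 + e / 4); last by field.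
rewrite lerD//; last by rewrite distrC (le_trans r2).
rewrite (le_trans (ler_normD _ _))// (_ : e / 4 * 2 = e / 4 + e / 4); last by field.
by rewrite lerD// ?(le_trans r1)// ltW.
Qed.

End QuantileLimit.

(** The affine change [Y = (K + X) / (2 K)] carries [[-K, K]] to [[0, 1]]. The measure is the law of
    [2 K Q - K] under the uniform distribution, with [Q] the limiting quantile function. *)
Theorem bounded_moment_problem (R : realType) (m : nat -> R) (K : R) : 0 < K ->
  m 0%N = 1 ->
  (forall i j, 0 <= polyfun m ((K%:P + 'X) ^+ i * (K%:P - 'X) ^+ j)) ->
  exists mu : probability R R,
    mu [set x : R | K < `|x|] = 0%E /\ forall r, moment mu r = m r.
Proof.
move=> K0 m0 m_ge0; pose Y : {poly R} := (2 * K)^-1 *: (K%:P + 'X).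
have K2 : 2 * K != 0 by rewrite mulf_neq0// gt_eqF.
pose l k := polyfun m (Y ^+ k).
have lE p : polyfun l p = polyfun m (p \Po Y).
  by rewrite comp_polyE linear_sum; apply: eq_bigr => i _; rewrite linearZ.
have Y1 : 1 - Y = (2 * K)^-1 *: (K%:P - 'X).
  have -> : 1 = (2 * K)^-1 *: (2 * K)%:P :> {poly R}.
    by rewrite -mul_polyC -polyCM mulVf.
  by rewrite -scalerBr; congr (_ *: _); rewrite mulr_natl mulr2n polyCD; ring.
have l0 : l 0%N = 1 by rewrite /l expr0 polyfunC.
have l_ge0 i j : 0 <= polyfun l ('X ^+ i * (1 - 'X) ^+ j).
  rewrite lE comp_polyM !rmorphXn /= comp_polyX comp_polyB comp_polyX.
  rewrite (comp_polyC 1) Y1 /Y !exprZn -scalerAl -scalerAr scalerA linearZ /=.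
  by rewrite mulr_ge0// mulr_ge0// exprn_ge0// invr_ge0 mulr_ge0// ltW.
have [Q [Qnd Q01 Ql]] := quantile_limit l0 l_ge0.
pose P := uniform_prob (@ltr01 R).
have mQ : measurable_fun setT Q by exact: nondecreasing_measurable.
pose p1 : {poly R} := (2 * K) *: 'X - K%:P.
have bQ : bounded_measurable setT Q by exact: bounded_measurable_monotone.
have P1 : P setT = 1%E by exact: probability_setT.
have PQ k : \int[P]_u (Q u ^+ k) = l k.
  rewrite -Ql /Rintegral; congr fine.
  rewrite integral_uniform ?subr0 ?invr1 ?mul1e//.
    by apply/measurable_EFinP; have [] := bounded_measurableX k bQ.
  by move=> u; rewrite lee_fin exprn_ge0//; have /andP[] := Q01 u.
pose X u := p1.[Q u].
have bX : bounded_measurable setT X by exact: bounded_measurable_horner.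
pose XX : {mfun (measurableTypeR R) >-> R} := MeasurableFun.Pack (MeasurableFun.Class
  (isMeasurableFun.Build _ _ (measurableTypeR R) _ X bX.1)).
exists (distribution P XX); split.
  rewrite /distribution /pushforward /=.
  rewrite (_ : _ @^-1` _ = set0) ?measure0//.
  apply/seteqP; split=> u //=; rewrite /X /p1 !hornerE ltNge => /negP; apply.
  have /andP[q0 q1] := Q01 u; rewrite ler_norml; apply/andP; split; nra.
move=> r; have bXr := bounded_measurableX r bX.
have mr : measurable_fun setT (fun x : R => x ^+ r) by exact: exprn_measurable.
rewrite /moment /Rintegral integral_distribution/=; first last.
- exact: bounded_measurable_integrable measurableT P1 _ bXr.
- exact/measurable_EFinP.
rewrite -/(Rintegral P setT (fun u => X u ^+ r)).
have -> : (fun u => X u ^+ r) = (fun u => (p1 ^+ r).[Q u]).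
  by apply/funext => u; rewrite horner_exp.
rewrite (bRintegral_horner measurableT P1)//.
under [X in polyfun X]eq_fun do rewrite PQ.
rewrite lE rmorphXn /= /p1 comp_polyB comp_polyZ comp_polyX comp_polyC.
by rewrite /Y scalerA mulfV// scale1r addrC addKr polyfunXn.
Qed.

(** * Cauchy transforms *)

Section ComplexIntegral.
Variables (R : realType) (mu : probability R R) (M : R).
Hypothesis mu0 : mu [set x : R | M < `|x|] = 0%E.
Implicit Types (f g : R -> R[i]).

Let D := centered_ball M.
Let mD : measurable D := measurable_centered_ball M.
Let muD : mu D = 1%E := centered_ball_mass mu0.

Definition cbounded_measurable f :=
  bounded_measurable D (fun x => complex.Re (f x)) /\
  bounded_measurable D (fun x => complex.Im (f x)).

Definition ball_integral f : R[i] :=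
  Complex (\int[mu]_(x in D) complex.Re (f x)) (\int[mu]_(x in D) complex.Im (f x)).

Lemma eq_ball_integral f g : {in D, f =1 g} -> ball_integral f = ball_integral g.
Proof.
by move=> fg; congr Complex; apply: eq_Rintegral => x xD; rewrite fg.
Qed.

Lemma cbounded_measurable_real (h : R -> R) : bounded_measurable D h ->
  cbounded_measurable (fun x => (h x)%:C).
Proof. by move=> bh; split => //=; exact: bounded_measurable_cst. Qed.

Lemma cbounded_measurable_cst (c : R[i]) : cbounded_measurable (fun=> c).
Proof. by split; exact: bounded_measurable_cst. Qed.

Lemma cbounded_measurableD f g : cbounded_measurable f ->
  cbounded_measurable g -> cbounded_measurable (fun x => f x + g x).
Proof.
move=> [f1 f2] [g1 g2]; split.
  have -> : (fun x => complex.Re (f x + g x)) =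
      (fun x => complex.Re (f x) + complex.Re (g x)).
    by apply/funext => x; rewrite raddfD.
  exact: bounded_measurableD.
have -> : (fun x => complex.Im (f x + g x)) =
    (fun x => complex.Im (f x) + complex.Im (g x)).
  by apply/funext => x; rewrite raddfD.
exact: bounded_measurableD.
Qed.

Lemma ReM (x y : R[i]) : complex.Re (x * y) =
  complex.Re x * complex.Re y + -1 * (complex.Im x * complex.Im y).
Proof. by case: x y => [a b] [c d] /=; rewrite mulN1r. Qed.

Lemma ImM (x y : R[i]) : complex.Im (x * y) =
  complex.Re x * complex.Im y + complex.Im x * complex.Re y.
Proof. by case: x y => [a b] [c d] /=. Qed.

Lemma cbounded_measurableM f g : cbounded_measurable f ->
  cbounded_measurable g -> cbounded_measurable (fun x => f x * g x).
Proof.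
move=> [f1 f2] [g1 g2]; split.
  under eq_fun do rewrite ReM; apply: bounded_measurableD.
    exact: bounded_measurableM.
  apply: bounded_measurableM; first exact: bounded_measurable_cst.
  exact: bounded_measurableM.
under eq_fun do rewrite ImM.
by apply: bounded_measurableD; exact: bounded_measurableM.
Qed.

Lemma ball_integral_cst c : ball_integral (fun=> c) = c.
Proof. by rewrite /ball_integral !(bRintegral_cst mD muD); case: c. Qed.

Lemma ball_integralD f g : cbounded_measurable f -> cbounded_measurable g ->
  ball_integral (fun x => f x + g x) = ball_integral f + ball_integral g.
Proof.
move=> [f1 f2] [g1 g2]; rewrite /ball_integral.
under eq_Rintegral do rewrite raddfD /=.
under [X in Complex _ X]eq_Rintegral do rewrite raddfD /=.
by rewrite !(bRintegralD mD muD).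
Qed.

Lemma ball_integralZ c f : cbounded_measurable f ->
  ball_integral (fun x => c * f x) = c * ball_integral f.
Proof.
move=> [f1 f2]; rewrite /ball_integral.
under eq_Rintegral do rewrite ReM.
under [X in Complex _ X]eq_Rintegral do rewrite ImM.
have bZ (a : R) h : bounded_measurable D h -> bounded_measurable D (fun x => a * h x).
  by move=> bh; apply: bounded_measurableM => //; exact: bounded_measurable_cst.
have b1 := bZ (complex.Re c) _ f1; have b2 := bZ (complex.Im c) _ f2.
have b3 := bZ (complex.Re c) _ f2; have b4 := bZ (complex.Im c) _ f1.
have b5 := bZ (-1) _ b2.
rewrite (bRintegralD mD muD b1 b5) (bRintegralD mD muD b3 b4).
rewrite (bRintegralZ mD muD _ f1) (bRintegralZ mD muD _ b2).
rewrite (bRintegralZ mD muD _ f2) (bRintegralZ mD muD _ f2) (bRintegralZ mD muD _ f1).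
by apply/eqP; rewrite eq_complex ReM ImM /= !eqxx.
Qed.

Lemma cbounded_measurable_sum (I : Type) (r : seq I) (F : I -> R -> R[i]) :
  (forall i, cbounded_measurable (F i)) ->
  cbounded_measurable (fun x => \sum_(i <- r) F i x).
Proof.
move=> bF; elim: r => [|i r IH].
  by under eq_fun do rewrite big_nil; exact: cbounded_measurable_cst.
by under eq_fun do rewrite big_cons; exact: cbounded_measurableD.
Qed.

Lemma cbounded_measurableX f m : cbounded_measurable f ->
  cbounded_measurable (fun x => f x ^+ m).
Proof.
move=> bf; elim: m => [|m IH].
  by under eq_fun do rewrite expr0; exact: cbounded_measurable_cst.
by under eq_fun do rewrite exprS; exact: cbounded_measurableM.
Qed.

Lemma ball_integral_sum (I : Type) (r : seq I) (F : I -> R -> R[i]) :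
  (forall i, cbounded_measurable (F i)) ->
  ball_integral (fun x => \sum_(i <- r) F i x) = \sum_(i <- r) ball_integral (F i).
Proof.
move=> bF; elim: r => [|i r IH].
  rewrite big_nil -[RHS](ball_integral_cst 0).
  by apply: eq_ball_integral => x _; rewrite big_nil.
rewrite big_cons -IH -ball_integralD//; last exact: cbounded_measurable_sum.
by apply: eq_ball_integral => x _; rewrite big_cons.
Qed.

Lemma cbounded_measurable_horner (q : {poly R[i]}) f : cbounded_measurable f ->
  cbounded_measurable (fun x => q.[f x]).
Proof.
move=> bf; under eq_fun do rewrite horner_coef.
apply: cbounded_measurable_sum => i; apply: cbounded_measurableM.
  exact: cbounded_measurable_cst.
exact: cbounded_measurableX.
Qed.

Lemma ball_integral_real (h : R -> R) :
  ball_integral (fun x => (h x)%:C) = (\int[mu]_(x in D) h x)%:C.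
Proof. by rewrite /ball_integral /= (bRintegral_cst mD muD). Qed.

Lemma ball_integral_horner (q : {poly R[i]}) (h : R -> R) :
  bounded_measurable D h ->
  ball_integral (fun x => q.[(h x)%:C]) =
  polyfun (fun k => (\int[mu]_(x in D) (h x ^+ k))%:C) q.
Proof.
move=> bh; have bX k : cbounded_measurable (fun x => (h x)%:C ^+ k).
  by apply: cbounded_measurableX; exact: cbounded_measurable_real.
transitivity (ball_integral (fun x => \sum_(i < size q) q`_i * (h x)%:C ^+ i)).
  by apply: eq_ball_integral => x _; rewrite horner_coef.
rewrite ball_integral_sum => [|i]; last first.
  by apply: cbounded_measurableM; [exact: cbounded_measurable_cst | exact: bX].
apply: eq_bigr => i _; rewrite ball_integralZ; last exact: bX.
congr (_ * _); rewrite -ball_integral_real.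
by apply: eq_ball_integral => x _; rewrite rmorphXn.
Qed.

Lemma norm_complex_le (a b : R) : `|Complex a b| <= (`|a| + `|b|)%:C.
Proof.
rewrite normc_def lecR -[leRHS]ger0_norm ?addr_ge0// -sqrtr_sqr ler_wsqrtr//=.
by rewrite sqrrD !real_normK ?num_real// lerD2r lerDl mulrn_wge0// mulr_ge0.
Qed.

Lemma normc_ge_Im (z : R[i]) : `|complex.Im z|%:C <= `|z|.
Proof. by rewrite normc_def lecR -sqrtr_sqr ler_wsqrtr// lerDr sqr_ge0. Qed.

(** The factor [2] comes from bounding real and imaginary parts separately and is harmless in the
    limits below. *)
Lemma ball_integral_bound f (B : R) : cbounded_measurable f ->
  (forall x, D x -> `|f x| <= B%:C) -> `|ball_integral f| <= (2 * B)%:C.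
Proof.
move=> [f1 f2] fB; rewrite (le_trans (norm_complex_le _ _))// lecR mulr_natl mulr2n.
rewrite lerD//; apply: (bRintegral_bound mD muD) => // x /fB; rewrite -lecR; apply: le_trans.
  exact: normc_ge_Re.
exact: normc_ge_Im.
Qed.

Lemma cintegral_ball f : cbounded_measurable f ->
  measurable_fun setT (fun x => complex.Re (f x)) ->
  measurable_fun setT (fun x => complex.Im (f x)) ->
  cintegral mu f = ball_integral f.
Proof.
move=> [f1 f2] m1 m2.
by rewrite /cintegral /ball_integral !(Rintegral_centered_ball mu0).
Qed.

End ComplexIntegral.

(** With [r = sqrt th], one factor [r^n] absorbs [n + 1], because [(n + 1) r^n] is at most the
    geometric sum, and the other tends to [0]. *)
Lemma le0_of_geometric (R : realType) (x C th : R) : 0 <= th < 1 ->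
  (forall n, x <= C * n.+1%:R * th ^+ n) -> x <= 0.
Proof.
move=> /andP[th0 th1] xC; pose r := Num.sqrt th.
have r0 : 0 <= r by exact: sqrtr_ge0.
have r1 : r < 1 by rewrite -sqrtr1 ltr_sqrt.
have rE n : th ^+ n = r ^+ n * r ^+ n by rewrite -exprMn -expr2 sqr_sqrtr.
have bound n : n.+1%:R * r ^+ n <= (1 - r)^-1.
  rewrite -[leRHS]mul1r ler_pdivlMr ?subr_gt0//.
  apply: (@le_trans _ _ ((1 - r) * \sum_(i < n.+1) r ^+ i)).
    rewrite mulrC ler_wpM2l ?subr_ge0 ?(ltW r1)// mulr_natl.
    have -> : r ^+ n *+ n.+1 = \sum_(i < n.+1) r ^+ n by rewrite sumr_const card_ord.
    apply: ler_sum => i _.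
    by rewrite ler_wiXn2l// ?(ltW r1)// -ltnS.
  by rewrite -[leLHS]opprK -mulNr opprB -subrX1 opprB lerBlDl lerDr exprn_ge0.
have xr n : x <= `|C| * (1 - r)^-1 * r ^+ n.
  rewrite (le_trans (xC n))// rE mulrA ler_wpM2r ?exprn_ge0//.
  rewrite -mulrA (le_trans (ler_norm _))// normrM ler_wpM2l//.
  by rewrite ger0_norm ?mulr_ge0 ?exprn_ge0.
have cvg0 : `|C| * (1 - r)^-1 * r ^+ n @[n --> \oo] --> 0.
  rewrite -[X in _ --> X](mulr0 (`|C| * (1 - r)^-1)); apply: cvgM; first exact: cvg_cst.
  by apply: cvg_expr; rewrite ger0_norm.
rewrite -(cvg_lim _ cvg0)//; apply: limr_ge; first by apply/cvg_ex; exists 0.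
by apply: nearW.
Qed.

(** * Resolvents on the upper half-plane *)

Section Resolvent.
Variables (R : realType).
Implicit Types (z : R[i]) (t x : R).

Definition resolvent z t x : R[i] := (z - (t * x)%:C)^-1.

Lemma resolvent_neq0 z t x : 0 < complex.Im z -> z - (t * x)%:C != 0.
Proof.
case: z => u v /= v0; apply/eqP => /(congr1 (@complex.Im R)) /=.
by rewrite subr0 => /eqP; rewrite gt_eqF.
Qed.

Lemma norm_resolvent z t x : 0 < complex.Im z ->
  `|resolvent z t x| <= ((complex.Im z)^-1)%:C.
Proof.
move=> v0; have n0 : 0 < `|z - (t * x)%:C| by rewrite normr_gt0 resolvent_neq0.
have v0C : 0 < (complex.Im z)%:C by rewrite ltcR.
rewrite normfV fmorphV lef_pV2// (le_trans _ (normc_ge_Im _))// lecR.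
by case: z v0 {n0 v0C} => u v /= v0; rewrite subr0 ler_norm.
Qed.

Lemma measurable_resolvent z t : 0 < complex.Im z ->
  measurable_fun setT (fun x => complex.Re (resolvent z t x)) /\
  measurable_fun setT (fun x => complex.Im (resolvent z t x)).
Proof.
case: z => u v /= v0.
have num x : (fun y => u - t * y) @ x --> u - t * x.
  apply: cvgB; first exact: cvg_cst.
  by apply: cvgM; [exact: cvg_cst | exact: cvg_id].
have den x : (fun y => ((u - t * y) ^+ 2 + (v - 0) ^+ 2)^-1) @ x -->
    ((u - t * x) ^+ 2 + (v - 0) ^+ 2)^-1.
  apply: cvgV; first by rewrite gt_eqF// ltr_wpDl ?sqr_ge0// subr0 exprn_gt0.
  by apply: cvgD; [apply: cvgM; exact: num | exact: cvg_cst].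
split; apply: continuous_measurable_fun => x.
  by apply: cvgM; [exact: num | exact: den].
by apply: cvgN; apply: cvgM; [exact: cvg_cst | exact: den].
Qed.

Lemma bounded_measurable_resolvent (D : set R) z t : measurable D ->
  0 < complex.Im z ->
  bounded_measurable D (fun x => complex.Re (resolvent z t x)) /\
  bounded_measurable D (fun x => complex.Im (resolvent z t x)).
Proof.
move=> mD v0; have [m1 m2] := measurable_resolvent t v0.
split; (split; first exact: measurable_funTS); exists (complex.Im z)^-1 => x _;
  rewrite -lecR (le_trans _ (norm_resolvent t x v0))//.
  exact: normc_ge_Re.
exact: normc_ge_Im.
Qed.

End Resolvent.

(** * The equation for the Cauchy transform *)

Section CauchyTransform.
Variables (R : realType) (mu nu : probability R R) (t K M : R) (mm : nat -> R).
Hypothesis t0 : 0 <= t.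
Hypothesis tM : t * M <= K.
Hypothesis mu0 : mu [set x : R | K < `|x|] = 0%E.
Hypothesis nu0 : nu [set x : R | M < `|x|] = 0%E.
Hypothesis mm0 : mm 0%N = 1.
Hypothesis mm1 : mm 1%N = 0.
Hypothesis mmSS : forall r,
  mm r.+2 = \sum_(p < r.+1) (t ^+ p * moment nu p) * mm (r - p)%N.
Hypothesis mu_mm : forall r, moment mu r = mm r.

Let mC k : R[i] := (mm k)%:C.
Let aC k : R[i] := (t ^+ k * moment nu k)%:C.

Let mC0 : mC 0%N = 1. Proof. by rewrite /mC mm0. Qed.
Let mC1 : mC 1%N = 0. Proof. by rewrite /mC mm1. Qed.
Let mCSS r : mC r.+2 = \sum_(p < r.+1) aC p * mC (r - p)%N.
Proof.
by rewrite /mC mmSS rmorph_sum; apply: eq_bigr => p _; rewrite rmorphM.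
Qed.

Lemma bounded_measurable_scale N c :
  bounded_measurable (centered_ball N) (fun x : R => c * x : R).
Proof.
split; first by apply: measurable_funM; [exact: measurable_cst | exact: measurable_id].
by exists (`|c| * N) => x Nx; rewrite normrM ler_wpM2l.
Qed.

Lemma moment_ball (rho : probability R R) N k :
  rho [set x : R | N < `|x|] = 0%E ->
  moment rho k = \int[rho]_(x in centered_ball N) (x ^+ k).
Proof.
move=> rho0; apply: (Rintegral_centered_ball rho0); last exact: exprn_measurable.
have := bounded_measurableX k (bounded_measurable_scale N 1).
by under eq_fun do rewrite mul1r.
Qed.

Lemma polyfun_mu (q : {poly R[i]}) :
  polyfun mC q = ball_integral mu K (fun x => q.[x%:C]).
Proof.
have bid : bounded_measurable (centered_ball K) (fun x : R => x).
  by have := bounded_measurable_scale K 1; under eq_fun do rewrite mul1r.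
rewrite (ball_integral_horner mu0 _ bid); congr polyfun.
by apply/funext => k; rewrite /mC -mu_mm (moment_ball _ mu0).
Qed.

Lemma polyfun_nu (q : {poly R[i]}) :
  polyfun aC q = ball_integral nu M (fun x => q.[(t * x)%:C]).
Proof.
rewrite (ball_integral_horner nu0 _ (bounded_measurable_scale M t)); congr polyfun.
apply/funext => k; rewrite /aC (moment_ball _ nu0); congr _%:C.
have mB := measurable_centered_ball M; have muB := centered_ball_mass nu0.
rewrite -(bRintegralZ mB muB); first by apply: eq_Rintegral => x _; rewrite exprMn.
have := bounded_measurableX k (bounded_measurable_scale M 1).
by under eq_fun do rewrite mul1r.
Qed.

Variable z : R[i].
Hypothesis z_up : 0 < complex.Im z.

(* A complex centre [w] far below the real axis for which the geometric series
   of [1/(z - x)] around [w] converges uniformly on [-K, K], however close [z]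
   is to the real axis. *)
Lemma expansion_center : exists (w : R[i]) (rho th : R),
  [/\ 0 < rho, 0 <= th < 1, z - w != 0, rho%:C * `|(z - w)^-1| = th%:C &
    forall x : R, `|x| <= K -> `|x%:C - w| <= rho%:C].
Proof.
case: z z_up => u v /= v0; set L := `|K| + `|u|.
have L0 : 0 <= L by rewrite addr_ge0.
(* The centre is [u - i Y], at distance [v + Y] from [z] and at most [sqrt (L^2 + Y^2)] from
   [[-K, K]]. The choice gives [v Y = L^2 + v^2], so [(v + Y)^2] exceeds [L^2 + Y^2]. *)
pose Y := L ^+ 2 / v + v; have Y0 : 0 < Y by rewrite ltr_wpDl// divr_ge0 ?sqr_ge0// ltW.
pose rho := Num.sqrt (L ^+ 2 + Y ^+ 2).
have rho0 : 0 < rho by rewrite sqrtr_gt0 ltr_wpDl ?sqr_ge0// exprn_gt0.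
have vY0 : 0 < v + Y by rewrite addr_gt0.
have zw : Complex u v - Complex u (- Y) = Complex 0 (v + Y).
  by apply/eqP; rewrite eq_complex /= subrr opprK !eqxx.
have nzw : `|Complex 0 (v + Y)| = (v + Y)%:C.
  by rewrite normc_def /= expr0n add0r sqrtr_sqr ger0_norm// ltW.
exists (Complex u (- Y)), rho, (rho / (v + Y)); rewrite zw normfV nzw; split => //.
- rewrite divr_ge0 ?ltW//= ltr_pdivrMr// mul1r.
  rewrite -[ltRHS]gtr0_norm// -sqrtr_sqr ltr_sqrt ?exprn_gt0//.
  have -> : (v + Y) ^+ 2 = v ^+ 2 + 2 * (v * Y) + Y ^+ 2 by ring.
  have -> : v * Y = L ^+ 2 + v ^+ 2 by rewrite /Y; field; rewrite gt_eqF.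
  have := exprn_gt0 2 v0; have := sqr_ge0 L; lra.
- by rewrite -normr_gt0 nzw ltcR.
- by rewrite -fmorphV -rmorphM.
move=> x xK; rewrite normc_def lecR /rho ler_wsqrtr//= opprK add0r lerD2r.
rewrite -[leLHS]real_normK ?num_real// lerXn2r ?nnegrE//.
by rewrite (le_trans (ler_normB _ _))// lerD// (le_trans xK)// ler_norm.
Qed.

(** For the partial sums [p n] of the geometric series of [1 / (z - x)], [L_m (p n)] approximates
    [G], while the divided-difference identity gives [L_m (p n) (z - g)] close to [1]. Both errors
    are bounded by a multiple of [(n + 1) th^n]. *)
Lemma cauchy_functional_equation :
  ball_integral mu K (resolvent z 1) *
    (z - ball_integral nu M (resolvent z t)) = 1.
Proof.
set G := ball_integral mu K _; set g := ball_integral nu M _.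
pose v := complex.Im z; have v0 : 0 < v := z_up.
have [w [rho [th [rho0 th01 zw thE ball_w]]]] := expansion_center.
have th0 : 0 <= th by case/andP: th01.
pose zeta := (z - w)^-1; pose sh : {poly R[i]} := 'X - w%:P.
pose p n : {poly R[i]} := \sum_(k < n) zeta ^+ k.+1 *: sh ^+ k.
(* The telescoped series [(z - X) p_n = 1 - zeta^n (X - w)^n], solved for [p_n X] so that
   [divdiffMX] and [polyfunMX] apply. *)
have pE n : p n * 'X = z *: p n - 1 + zeta ^+ n *: sh ^+ n.
  suff : (z%:P - 'X) * p n = 1 - zeta ^+ n *: sh ^+ n.
    by move/eqP; rewrite mulrBl subr_eq mul_polyC => /eqP ->; rewrite mulrC; ring.
  elim: n => [|n IH]; first by rewrite /p big_ord0 mulr0 !expr0 scale1r subrr.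
  rewrite /p big_ord_recr /= mulrDr -/(p n) IH.
  have -> : z%:P - 'X = (z - w)%:P - sh by rewrite /sh polyCB; ring.
  rewrite mulrBl mul_polyC scalerA -scalerAr -exprS.
  have -> : (z - w) * zeta ^+ n.+1 = zeta ^+ n by rewrite exprS mulrA mulfV// mul1r.
  by rewrite addrA subrK.
pose Lam n := polyfun mC (p n).
have bx : cbounded_measurable K (fun x : R => x%:C).
  apply: cbounded_measurable_real.
  by have := bounded_measurable_scale K 1; under eq_fun do rewrite mul1r.
have by_ : cbounded_measurable M (fun x : R => (t * x)%:C).
  exact/cbounded_measurable_real/bounded_measurable_scale.
have shb n x : `|x| <= K -> `|(sh ^+ n).[x%:C]| <= (rho ^+ n)%:C.
  move=> xK; rewrite horner_exp hornerXsubC normrX rmorphXn lerXn2r ?nnegrE//.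
    by rewrite lecR ltW.
  exact: ball_w.
have Mb n : `|polyfun mC (sh ^+ n)| <= (2 * rho ^+ n)%:C.
  rewrite polyfun_mu; apply: (ball_integral_bound mu0) => [|x /= xK].
    exact: cbounded_measurable_horner.
  exact: shb.
have zeta_rho n : `|zeta| ^+ n * (rho ^+ n)%:C = (th ^+ n)%:C.
  by rewrite rmorphXn -exprMn mulrC thE rmorphXn.
have tK x : `|x| <= M -> `|t * x| <= K.
  by move=> xM; rewrite normrM ger0_norm// (le_trans _ tM)// ler_wpM2l.
have stepA n : `|G - Lam n| <= (2 * (th ^+ n * v^-1))%:C.
  have bres : cbounded_measurable K (resolvent z 1).
    exact: bounded_measurable_resolvent (measurable_centered_ball K) z_up.
  have bE : cbounded_measurable K
      (fun x : R => zeta ^+ n * ((sh ^+ n).[x%:C] * resolvent z 1 x)).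
    apply: cbounded_measurableM; first exact: cbounded_measurable_cst.
    by apply: cbounded_measurableM => //; exact: cbounded_measurable_horner.
  (* The pointwise remainder of the series is [zeta^n (x - w)^n / (z - x)]. *)
  have -> : G - Lam n = ball_integral mu K
      (fun x : R => zeta ^+ n * ((sh ^+ n).[x%:C] * resolvent z 1 x)).
    apply/eqP; rewrite subr_eq addrC /Lam polyfun_mu -ball_integralD//; last first.
      exact: cbounded_measurable_horner.
    apply/eqP; apply: eq_ball_integral => x _.
    rewrite -[RHS]/((p n).[x%:C] + zeta ^+ n * ((sh ^+ n).[x%:C] * resolvent z 1 x)).
    have : (p n).[x%:C] * x%:C = z * (p n).[x%:C] - 1 + zeta ^+ n * (sh ^+ n).[x%:C].
      have := congr1 (fun q => q.[x%:C]) (pE n).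
      by rewrite /sh horner_exp hornerXsubC !hornerE.
    rewrite /resolvent mul1r.
    have : z - x%:C != 0 by have := resolvent_neq0 1 x z_up; rewrite mul1r.
    set A := (p n).[_]; set B := (sh ^+ n).[_] => zx H.
    apply: (mulfI zx); rewrite mulfV// mulrDr.
    have -> : (z - x%:C) * (zeta ^+ n * (B / (z - x%:C))) = zeta ^+ n * B.
      by field.
    have -> : (z - x%:C) * A = z * A - A * x%:C by ring.
    by rewrite H; ring.
  apply: (ball_integral_bound mu0) bE _ => x /= xK.
  rewrite !normrM normrX mulrA [leRHS]rmorphM /= ler_pM ?mulr_ge0 ?exprn_ge0//; last exact: norm_resolvent.
  by rewrite -zeta_rho ler_wpM2l// shb.
have stepB n : `|Lam n * (z - g) - 1| <=
    ((2 + 4 * `|rho^-1| * v^-1) * n.+1%:R * th ^+ n)%:C.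
  pose r := divdiff mC (sh ^+ n).
  (* Each of the [n] terms of [divdiff_shift] is at most [2 rho^(n - 1)]; writing [rho^n / rho]
     avoids the predecessor at [n = 0]. *)
  have rb y : `|y| <= K -> `|r.[y%:C]| <= (n%:R * (2 * (rho ^+ n / rho)))%:C.
    move=> yK; rewrite /r divdiff_shift horner_sum.
    rewrite (le_trans (ler_norm_sum _ _ _))//.
    have -> : (n%:R * (2 * (rho ^+ n / rho)))%:C =
        \sum_(i < n) (2 * (rho ^+ n / rho))%:C.
      by rewrite sumr_const card_ord -rmorphMn mulr_natl.
    apply: ler_sum => i _; rewrite hornerZ normrM.
    apply: (@le_trans _ _ ((2 * rho ^+ (n.-1 - i))%:C * (rho ^+ i)%:C)).
      by rewrite ler_pM// shb.
    rewrite -rmorphM lecR -mulrA -exprD subnK; last by have := ltn_ord i; lia.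
    case: (n) i => [[]//|k _] /=; rewrite exprSr mulfK ?gt_eqF//.
  have Df : divdiff mC (p n) * 'X =
      z *: divdiff mC (p n) - (Lam n)%:P + zeta ^+ n *: r.
    have := congr1 (divdiff mC) (pE n).
    rewrite divdiffMX linearD linearB !linearZ /= (divdiffC _ 1) subr0 -/r.
    by move=> /(canRL (addKr _)) ->; rewrite -/(Lam n); ring.
  have La : polyfun aC (divdiff mC (p n)) =
      z * Lam n - 1 + zeta ^+ n * polyfun mC (sh ^+ n).
    rewrite -(polyfunMX mC1 mCSS) pE linearD linearB !linearZ /=.
    by rewrite (polyfunC _ mC0).
  have bres : cbounded_measurable M (resolvent z t).
    exact: bounded_measurable_resolvent (measurable_centered_ball M) z_up.
  have bR : cbounded_measurable M (fun x => r.[(t * x)%:C] * resolvent z t x).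
    by apply: cbounded_measurableM => //; exact: cbounded_measurable_horner.
  pose J := ball_integral nu M (fun x => r.[(t * x)%:C] * resolvent z t x).
  (* [Df] says [(z - y) D p_n = L_m p_n - zeta^n r]; dividing by [z - y] and integrating against
     [nu] gives a second expression for the quantity in [La]. *)
  have LaJ : polyfun aC (divdiff mC (p n)) = Lam n * g + (- zeta ^+ n) * J.
    rewrite polyfun_nu /g /J -!(ball_integralZ nu0)// -(ball_integralD nu0); last 2 first.
    - by apply: cbounded_measurableM => //; exact: cbounded_measurable_cst.
    - by apply: cbounded_measurableM => //; exact: cbounded_measurable_cst.
    apply: eq_ball_integral => x _.
    rewrite -[RHS]/(Lam n * resolvent z t x +
      - zeta ^+ n * (r.[(t * x)%:C] * resolvent z t x)).
    have : (divdiff mC (p n)).[(t * x)%:C] * (t * x)%:C =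
        z * (divdiff mC (p n)).[(t * x)%:C] - Lam n + zeta ^+ n * r.[(t * x)%:C].
      by have := congr1 (fun q => q.[(t * x)%:C]) Df; rewrite !hornerE.
    rewrite /resolvent; move: (resolvent_neq0 t x z_up).
    set y := (t * x)%:C; set A := (divdiff mC (p n)).[y]; set B := r.[y].
    clearbody A B y => zx H.
    apply: (mulfI zx).
    have -> : (z - y) * A = z * A - A * y by ring.
    by rewrite H; field.
  have Jb : `|J| <= (2 * (n%:R * (2 * (rho ^+ n / rho)) * v^-1))%:C.
    apply: (ball_integral_bound nu0) bR _ => x /= xM.
    by rewrite normrM [leRHS]rmorphM /= ler_pM ?norm_resolvent// rb// tK.
  have -> : Lam n * (z - g) - 1 =
      - (zeta ^+ n * polyfun mC (sh ^+ n)) - zeta ^+ n * J.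
    have := LaJ; rewrite La => H; rewrite mulrBr.
    have -> : Lam n * g = z * Lam n - 1 + zeta ^+ n * polyfun mC (sh ^+ n) + zeta ^+ n * J.
      by rewrite H; ring.
    by ring.
  rewrite (le_trans (ler_normB _ _))// normrN !normrM normrX.
  apply: (@le_trans _ _ (`|zeta| ^+ n * (2 * rho ^+ n)%:C +
      `|zeta| ^+ n * (2 * (n%:R * (2 * (rho ^+ n / rho)) * v^-1))%:C)).
    by rewrite lerD// ler_wpM2l// exprn_ge0.
  have -> : (2 * rho ^+ n)%:C = (rho ^+ n)%:C * 2%:C by rewrite -rmorphM mulrC.
  have -> : (2 * (n%:R * (2 * (rho ^+ n / rho)) * v^-1))%:C =
      (rho ^+ n)%:C * (4 * n%:R / rho * v^-1)%:C.
    by rewrite -rmorphM; congr _%:C; field; rewrite !gt_eqF.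
  rewrite !mulrA zeta_rho -!rmorphM -rmorphD lecR.
  rewrite gtr0_norm ?invr_gt0//.
  rewrite [leRHS](_ : _ = th ^+ n * 2 * n.+1%:R + th ^+ n * (4 * n.+1%:R / rho * v^-1)); last first.
    by ring.
  rewrite lerD//.
    by rewrite ler_peMr ?mulr_ge0 ?exprn_ge0// ler1n.
  rewrite ler_wpM2l ?exprn_ge0// !ler_wpM2r ?invr_ge0 ?(ltW rho0) ?(ltW v0)//.
  by rewrite /= -natrM ler_nat leq_mul2l leqnSn orbT.
have zg : exists2 c : R, 0 <= c & `|z - g| = c%:C.
  exists (complex.Re `|z - g|); last by rewrite normc_def.
  by rewrite normc_def /= sqrtr_ge0.
have [c c0 cE] := zg.
have [d dE] : exists d : R, `|G * (z - g) - 1| = d%:C.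
  by exists (complex.Re `|G * (z - g) - 1|); rewrite normc_def.
apply/eqP; rewrite -subr_eq0 -normr_le0 dE lecR.
pose C := 2 * v^-1 * c + (2 + 4 * `|rho^-1| * v^-1).
apply: (@le0_of_geometric _ _ C th th01) => n.
rewrite -lecR -dE.
have -> : G * (z - g) - 1 = (G - Lam n) * (z - g) + (Lam n * (z - g) - 1) by ring.
rewrite (le_trans (ler_normD _ _))// normrM cE.
apply: (le_trans (lerD (ler_wpM2r _ (stepA n)) (stepB n))); first by rewrite lecR.
rewrite -rmorphM -rmorphD lecR /C.
set e := 2 + 4 * _ * _.
have -> : (2 * v^-1 * c + e) * n.+1%:R * th ^+ n =
    2 * (th ^+ n * v^-1) * c * n.+1%:R + e * n.+1%:R * th ^+ n by ring.
rewrite lerD2r ler_peMr ?ler1n//.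
by rewrite !mulr_ge0 ?invr_ge0 ?exprn_ge0 ?(ltW v0).
Qed.

End CauchyTransform.

(** * Determinacy *)

Section CauchyMoments.
Variables (R : realType) (mu mu' : probability R R) (M : R).
Hypothesis mu0 : mu [set x : R | M < `|x|] = 0%E.
Hypothesis mu0' : mu' [set x : R | M < `|x|] = 0%E.

(** The Cauchy transform of the measure [x^k rho(dx)]. *)
Let V (rho : probability R R) k (z : R[i]) :=
  ball_integral rho M (fun x => x%:C ^+ k * resolvent z 1 x).

Let bX k : bounded_measurable (centered_ball M) (fun x : R => x ^+ k : R).
Proof.
have := bounded_measurableX k (bounded_measurable_scale M 1).
by under eq_fun do rewrite mul1r.
Qed.

Let cbX k : cbounded_measurable M (fun x : R => x%:C ^+ k).
Proof.
have := cbounded_measurable_real (bX k).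
by under eq_fun do rewrite rmorphXn.
Qed.

Let cbV k (z : R[i]) : 0 < complex.Im z ->
  cbounded_measurable M (fun x : R => x%:C ^+ k * resolvent z 1 x).
Proof.
move=> z0; apply: cbounded_measurableM; first exact: cbX.
exact: bounded_measurable_resolvent (measurable_centered_ball M) z0.
Qed.

(** Integrates [x / (z - x) = z / (z - x) - 1] against [x^k]. *)
Let V_rec (rho : probability R R) k (z : R[i]) : rho [set x : R | M < `|x|] = 0%E -> 0 < complex.Im z ->
  V rho k.+1 z = z * V rho k z - (moment rho k)%:C.
Proof.
move=> rho0 z0; rewrite (moment_ball _ rho0) -(ball_integral_real rho0).
rewrite /V -(ball_integralZ rho0); last exact: cbV.
apply/eqP; rewrite eq_sym subr_eq eq_sym -(ball_integralD rho0); last 2 first.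
- exact: cbV.
- exact: cbounded_measurable_real.
apply/eqP; apply: eq_ball_integral => x _.
rewrite -[LHS]/(x%:C ^+ k.+1 * resolvent z 1 x + (x ^+ k)%:C).
have := resolvent_neq0 1 x z0; rewrite /resolvent mul1r rmorphXn exprS => zx.
by move: (_ ^+ k) => A; field.
Qed.

Let V_bound (rho : probability R R) k (z : R[i]) : rho [set x : R | M < `|x|] = 0%E -> 0 < complex.Im z ->
  `|V rho k z| <= (2 * (`|M| ^+ k / complex.Im z))%:C.
Proof.
move=> rho0 z0; apply: (ball_integral_bound rho0); first exact: cbV.
move=> x /= xM; rewrite normrM [leRHS]rmorphM /= ler_pM//; last exact: norm_resolvent.
rewrite normrX normc_def /= expr0n addr0 sqrtr_sqr -rmorphXn lecR.
by rewrite lerXn2r ?nnegrE// (le_trans xM)// ler_norm.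
Qed.

(** If the [k]-th transforms agree, then by [V_rec] the [k]-th moments differ by the difference of
    the next transforms, which is of order [1 / y] at [z = i y]. Hence the moments agree, and then
    so do the next transforms. *)
Lemma moments_of_cauchy :
  (forall z : R[i], 0 < complex.Im z -> ball_integral mu M (resolvent z 1) =
     ball_integral mu' M (resolvent z 1)) ->
  forall k, moment mu k = moment mu' k.
Proof.
move=> mumu'.
suff VV k : forall z : R[i], 0 < complex.Im z -> V mu k z = V mu' k z.
  move=> k; have H (z : R[i]) : 0 < complex.Im z -> (moment mu k)%:C = (moment mu' k)%:C.
    move=> z0; have := VV k.+1 z z0; rewrite !V_rec// VV// => /addrI /oppr_inj //.
  by apply: complexI; apply: (H 'i); rewrite /= ltr01.
elim: k => [|k IH] z z0.
  rewrite /V; have -> : (fun x : R => x%:C ^+ 0 * resolvent z 1 x) = resolvent z 1.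
    by apply/funext => x; rewrite expr0 mul1r.
  exact: mumu'.
suff mk : moment mu k = moment mu' k by rewrite !V_rec// IH// mk.
apply/eqP; rewrite -subr_eq0 -normr_le0 leNgt; apply/negP => e0.
(* The summand [1] makes [e y] exceed [4 |M|^(k + 1)] by [e], against the bound. *)
set e := `|_| in e0; pose y := 4 * (`|M| ^+ k.+1) / e + 1.
have y0 : 0 < y by rewrite ltr_wpDl// divr_ge0 ?mulr_ge0 ?exprn_ge0// ltW.
have y0C : 0 < complex.Im (Complex 0 y) by [].
have : e%:C <= (4 * `|M| ^+ k.+1 / y)%:C.
  have -> : e%:C = `|V mu' k.+1 (Complex 0 y) - V mu k.+1 (Complex 0 y)|.
    rewrite !V_rec// IH// opprB addrC addrA subrK -rmorphB normc_def /=.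
    by rewrite expr0n addr0 sqrtr_sqr.
  rewrite (le_trans (ler_normB _ _))//.
  apply: (le_trans (lerD (V_bound _ mu0' y0C) (V_bound _ mu0 y0C))).
  by rewrite -rmorphD lecR /= -mulrDl -natrD mulrA.
rewrite lecR ler_pdivlMr// /y mulrDr mulr1 mulrC divfK ?gt_eqF//.
by rewrite gerDl leNgt e0.
Qed.

End CauchyMoments.

(** * Compactly supported measures are determined by their moments *)

Section MomentDeterminacy.
Variables (R : realType).

Lemma bernoulli_ge (u : R) N : 0 <= u <= 1 -> 1 - N%:R * u <= (1 - u) ^+ N.
Proof.
move=> /andP[u0 u1]; elim: N => [|N IH]; first by rewrite mul0r subr0 expr0.
rewrite exprS; have : (1 - u) * (1 - N%:R * u) <= (1 - u) * (1 - u) ^+ N.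
  by rewrite ler_wpM2l// subr_ge0.
have := mulr_ge0 (ler0n R N) (sqr_ge0 u); rewrite -natr1; nra.
Qed.

(** From [N u <= (1 + u)^N] and [(1 - u^2)^N <= 1]. Together with Bernoulli's inequality it controls
    [(1 - Y^n)^(2^n)] on the two sides of the midpoint. *)
Lemma expr_1sub_le (u : R) N : 0 <= u <= 1 -> N%:R * u * (1 - u) ^+ N <= 1.
Proof.
move=> /andP[u0 u1].
have h : N%:R * u <= (1 + u) ^+ N.
  elim: N => [|N IH]; first by rewrite mul0r expr0 ler01.
  have h1 : 1 <= (1 + u) ^+ N by rewrite exprn_ege1// lerDl.
  by rewrite exprS -natr1; nra.
have v0 : 0 <= (1 - u) ^+ N by rewrite exprn_ge0// subr_ge0.
rewrite (le_trans (ler_wpM2r v0 h))// -exprMn exprn_ile1//.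
  by rewrite mulr_ge0 ?subr_ge0// addr_ge0.
by have := sqr_ge0 u; nra.
Qed.

(* The polynomials [(1 - Y^n)^(2^n)], with [Y] affine and [Y = 1/2] midway between
   [a] and [b], converge to the indicator of the half-line, uniformly away from
   that midpoint. *)
Lemma halfline_le (mu mu' : probability R R) (M : R) (a b : R) :
  mu [set x : R | M < `|x|] = 0%E -> mu' [set x : R | M < `|x|] = 0%E ->
  (forall k, moment mu k = moment mu' k) -> a < b ->
  \int[mu]_(x in centered_ball M) (x <= a)%R%:R <=
  \int[mu']_(x in centered_ball M) (x < b)%R%:R :> R.
Proof.
move=> mu0 mu0' mumu' ab.
have mB := measurable_centered_ball M.
have muB := centered_ball_mass mu0; have muB' := centered_ball_mass mu0'.
(* [L] bounds [|x - c|] on the ball, so [Y] takes values in [[1/4, 3/4]] there; [eta] is the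
   distance of [2 Y] from [1] at [a] and at [b]. *)
pose c := (a + b) / 2; pose L := `|M| + `|c| + 1.
have L0 : 0 < L by rewrite ltr_wpDl// addr_ge0.
pose eta := (b - a) / (4 * L).
have L4 : 0 <= (4 * L)^-1 by rewrite invr_ge0 mulr_ge0// ltW.
have eta0 : 0 < eta by rewrite divr_gt0 ?subr_gt0// mulr_gt0.
pose Y : {poly R} := (2^-1 - c / (4 * L))%:P + (4 * L)^-1 *: 'X.
pose p n : {poly R} := (1 - Y ^+ n) ^+ (2 ^ n).
(* One rate serves both sides: left of [a], [2 Y <= 1 - eta <= r] and the value of [p n] is at least
   [1 - (2 Y)^n]; right of [b], [2 Y >= 1 + eta] and that value is at most [(2 Y)^-n]. *)
pose r := (1 + eta)^-1.
have r0 : 0 <= r by rewrite invr_ge0 addr_ge0// ltW.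
have r1 : r < 1 by rewrite invf_lt1 ?ltrDl// addr_gt0.
have YE x : Y.[x] = 2^-1 + (x - c) / (4 * L) by rewrite /Y !hornerE; ring.
have Y01 x : `|x| <= M -> 0 <= Y.[x] <= 1.
  move=> xM; have : `|x - c| <= L.
    rewrite (le_trans (ler_normB _ _))// /L (le_trans _ (_ : `|M| + `|c| <= _))// ?lerDl//.
    by rewrite lerD2r (le_trans xM)// ler_norm.
  rewrite ler_norml YE => /andP[h1 h2].
  have -> : 2^-1 + (x - c) / (4 * L) = (2 * L + (x - c)) / (4 * L).
    by field; rewrite gt_eqF.
  apply/andP; split; first by rewrite divr_ge0 ?mulr_ge0 ?(ltW L0)//; lra.
  by rewrite ler_pdivrMr ?mulr_gt0//; lra.
have pE n x : (p n).[x] = (1 - Y.[x] ^+ n) ^+ (2 ^ n).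
  by rewrite /p !(horner_exp, hornerE).
have Yn01 n x : `|x| <= M -> 0 <= Y.[x] ^+ n <= 1.
  by move=> /Y01/andP[h0 h1]; rewrite exprn_ge0//= exprn_ile1.
have p01 n x : `|x| <= M -> 0 <= (p n).[x] <= 1.
  move=> xM; rewrite pE; have /andP[h0 h1] := Yn01 n x xM.
  by rewrite exprn_ge0 ?subr_ge0//= exprn_ile1 ?subr_ge0// gerBl.
have p_lo n x : `|x| <= M -> x <= a -> 1 - r ^+ n <= (p n).[x].
  move=> xM xa; rewrite pE.
  apply: le_trans (bernoulli_ge _ (Yn01 n x xM)); rewrite lerB//.
  rewrite natrX -exprMn lerXn2r ?nnegrE//.
    by have /andP[h0 _] := Y01 x xM; rewrite mulr_ge0.
  rewrite /r -[leRHS]mul1r ler_pdivlMr; last by rewrite addr_gt0.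
  have : 2 * Y.[x] <= 1 - eta.
    have h : (x - c) / (4 * L) <= (a - c) / (4 * L) by rewrite ler_wpM2r// lerD2r.
    have E : (a - c) / (4 * L) = - eta / 2 by rewrite /eta /c; field; rewrite gt_eqF.
    by rewrite YE; lra.
  have := sqr_ge0 eta; have /andP[h0 _] := Y01 x xM; nra.
have p_hi n x : `|x| <= M -> b <= x -> (p n).[x] <= r ^+ n.
  move=> xM bx; rewrite pE.
  have := expr_1sub_le (2 ^ n) (Yn01 n x xM); rewrite natrX -exprMn.
  set w := (_ - _) ^+ _; have w0 : 0 <= w.
    by rewrite exprn_ge0// subr_ge0; have /andP[] := Yn01 n x xM.
  have h : 1 + eta <= 2 * Y.[x].
    have h : (b - c) / (4 * L) <= (x - c) / (4 * L) by rewrite ler_wpM2r// lerD2r.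
    have E : (b - c) / (4 * L) = eta / 2 by rewrite /eta /c; field; rewrite gt_eqF.
    by rewrite YE; lra.
  have e1 : 0 < (1 + eta) ^+ n by rewrite exprn_gt0// addr_gt0.
  move=> hw; rewrite /r exprVn -[leRHS]mul1r ler_pdivlMr// mulrC.
  apply: le_trans hw.
  by rewrite ler_wpM2r// lerXn2r ?nnegrE// ?(le_trans _ h)// addr_ge0// ltW.
have bid : bounded_measurable (centered_ball M) (fun x : R => x).
  by have := bounded_measurable_scale M 1; under eq_fun do rewrite mul1r.
have bp n : bounded_measurable (centered_ball M) (fun x : R => (p n).[x]).
  exact: bounded_measurable_horner.
have pp n : \int[mu]_(x in centered_ball M) (p n).[x] =
    \int[mu']_(x in centered_ball M) (p n).[x].
  rewrite (bRintegral_horner mB muB)// (bRintegral_horner mB muB')//.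
  by congr polyfun; apply/funext => k; rewrite -!moment_ball.
have b_le : bounded_measurable (centered_ball M) (fun x : R => (x <= a)%R%:R : R).
  have -> : (fun x : R => (x <= a)%R%:R) = (fun x : R => 1 + -1 * (a < x)%R%:R :> R).
    apply/funext => x; case: leP => _; rewrite ?mulr0 ?addr0// mulr1 subrr//.
  apply: bounded_measurableD; first exact: bounded_measurable_cst.
  apply: bounded_measurableM; first exact: bounded_measurable_cst.
  exact: bounded_measurable_lt.
have b_lt : bounded_measurable (centered_ball M) (fun x : R => (x < b)%R%:R : R).
  have -> : (fun x : R => (x < b)%R%:R) = (fun x : R => 1 + -1 * (b <= x)%R%:R :> R).
    apply/funext => x; case: ltP => _; rewrite ?mulr0 ?addr0// mulr1 subrr//.
  apply: bounded_measurableD; first exact: bounded_measurable_cst.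
  apply: bounded_measurableM; first exact: bounded_measurable_cst.
  exact: bounded_measurable_le.
rewrite -subr_le0; apply: (@le0_of_geometric _ _ 2 r); first by rewrite r0.
move=> n; rewrite lerBlDr.
have rn : r ^+ n + r ^+ n <= 2 * n.+1%:R * r ^+ n.
  have -> : r ^+ n + r ^+ n = 2 * r ^+ n by ring.
  by rewrite ler_wpM2r ?exprn_ge0// ler_peMr// ler1n.
apply: (@le_trans _ _ (\int[mu]_(x in centered_ball M) ((p n).[x] + r ^+ n))).
  apply: (ler_bRintegral mB muB) => //.
    by apply: bounded_measurableD => //; exact: bounded_measurable_cst.
  move=> x xM; case: (leP x a) => xa; last first.
    by rewrite addr_ge0 ?exprn_ge0//; have /andP[] := p01 n x xM.
  by rewrite -lerBlDr p_lo.
rewrite (bRintegralD mB muB)//; last exact: bounded_measurable_cst.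
rewrite (bRintegral_cst mB muB) pp.
apply: (@le_trans _ _ (\int[mu']_(x in centered_ball M) ((x < b)%R%:R + r ^+ n) + r ^+ n)).
  rewrite lerD2r; apply: (ler_bRintegral mB muB') => //.
    by apply: bounded_measurableD => //; exact: bounded_measurable_cst.
  move=> x xM; case: (ltP x b) => xb.
    by have /andP[_ h] := p01 n x xM; rewrite (le_trans h)// lerDl exprn_ge0.
  by rewrite add0r p_hi.
rewrite (bRintegralD mB muB')//; last exact: bounded_measurable_cst.
by rewrite (bRintegral_cst mB muB') -addrA addrC lerD2r.
Qed.

Lemma measure_ball_indic (rho : probability R R) (M : R) (A : set R) :
  rho [set x : R | M < `|x|] = 0%E -> measurable A ->
  (\int[rho]_(x in centered_ball M) \1_A x)%:E = rho A.
Proof.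
move=> rho0 mA; have mB := measurable_centered_ball M.
rewrite /Rintegral integral_indic// fineK; last by rewrite fin_num_measure//; exact: measurableI.
have mAB : measurable (A `\` centered_ball M) by exact: measurableD.
have AB0 : rho (A `\` centered_ball M) = 0%E.
  apply/eqP; rewrite -measure_le0 -rho0 -setC_centered_ball le_measure ?inE//.
  exact: measurableC.
rewrite -[LHS]add0e -AB0; exact/esym/(measureDI rho mA mB).
Qed.

(** The open half-line is the increasing union of the closed ones ending at [b - 1 / (n + 1)], each
    compared with the open one by [halfline_le]. *)
Lemma halfline_measure_le (mu mu' : probability R R) (M b : R) :
  mu [set x : R | M < `|x|] = 0%E -> mu' [set x : R | M < `|x|] = 0%E ->
  (forall k, moment mu k = moment mu' k) ->
  (mu `]-oo, b[%classic <= mu' `]-oo, b[%classic)%E.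
Proof.
move=> mu0 mu0' mumu'.
pose F n : set R := `]-oo, b - n.+1%:R^-1]%classic.
have FE : \bigcup_n F n = `]-oo, b[%classic.
  apply/seteqP; split=> [x [n _]|x]; rewrite /F /= !in_itv /=.
    by move=> /le_lt_trans; apply; rewrite ltrBlDr ltrDl invr_gt0.
  move=> xb; have bx : 0 < b - x by rewrite subr_gt0.
  exists (Num.truncn (b - x)^-1) => //=; rewrite in_itv /= lerBrDr addrC -lerBrDr.
  by rewrite invf_ple ?posrE// ltW// truncnS_gt.
have : mu \o F @ \oo --> mu (\bigcup_n F n).
  apply: nondecreasing_cvg_mu.
  - by move=> n; exact: measurable_itv.
  - by rewrite FE; exact: measurable_itv.
  - apply/nondecreasing_seqP => n; apply/subsetPset => x; rewrite /F /= !in_itv /=.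
    move=> /le_trans; apply; rewrite lerD2l lerN2 lef_pV2 ?posrE// ler_nat.
    exact: leqnSn.
rewrite FE => muF; rewrite -(cvg_lim _ muF)//; apply: lime_le.
  by apply/cvg_ex; eexists; exact: muF.
apply: nearW => n /=; rewrite -(measure_ball_indic mu0); last exact: measurable_itv.
rewrite -(measure_ball_indic mu0'); last exact: measurable_itv.
rewrite lee_fin; have bn : b - n.+1%:R^-1 < b by rewrite ltrBlDr ltrDl invr_gt0.
have := halfline_le mu0 mu0' mumu' bn.
rewrite (_ : (fun x : R => (x <= b - n.+1%:R^-1)%R%:R) = \1_(F n)); last first.
  by apply/funext => x; rewrite indicE mem_setE in_itv.
rewrite (_ : (fun x : R => (x < b)%R%:R) = \1_(`]-oo, b[%classic)) //.
by apply/funext => x; rewrite indicE mem_setE in_itv.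
Qed.

(** The inequality in both directions gives equality on open half-lines, an intersection-stable
    generator of the Borel sets. *)
Lemma probability_eq_of_moments (mu mu' : probability R R) (M : R) :
  mu [set x : R | M < `|x|] = 0%E -> mu' [set x : R | M < `|x|] = 0%E ->
  (forall k, moment mu k = moment mu' k) ->
  forall B : set R, measurable B -> mu' B = mu B.
Proof.
move=> mu0 mu0' mumu' B mB.
apply: (measure_unique (@RGenInftyO.G R) (fun n => `]-oo, n%:R[%classic)).
- exact: RGenInftyO.measurableE.
- move=> _ _ [x ->] [y ->]; exists (Num.min x y).
  by apply/seteqP; split=> u /=; rewrite !in_itv /= lt_min => /andP.
- by move=> n; exists n%:R.
- rewrite -subTset => x _; exists (Num.truncn `|x|).+1 => //=; rewrite in_itv /=.
  by rewrite (le_lt_trans (ler_norm x))// truncnS_gt.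
- move=> _ [x ->]; apply/eqP; rewrite eq_le.
  rewrite (halfline_measure_le _ mu0' mu0) ?(halfline_measure_le _ mu0 mu0')//.
- by move=> n; rewrite -ge0_fin_numE// fin_num_measure//; exact: measurable_itv.
- exact: mB.
Qed.

End MomentDeterminacy.

(** * The limit moment sequence and the transforms over a ball *)

Section JacobiSequence.
Variables (F : pzSemiRingType) (a : nat -> F).

(** The recursion refers to all earlier values, so the list of the first [n] of them is built
    structurally. *)
Fixpoint jacobi_list n : seq F :=
  if n is n'.+1 then
    let s := jacobi_list n' in
    rcons s (match n' with
             | 0 => 1
             | 1 => 0
             | r.+2 => \sum_(p < r.+1) a p * s`_(r - p)
             end)
  else [::].

Definition jacobi_moment n : F := (jacobi_list n.+1)`_n.

Lemma size_jacobi_list n : size (jacobi_list n) = n.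
Proof. by elim: n => //= n IH; rewrite size_rcons IH. Qed.

Lemma nth_jacobi_list n i : (i < n)%N -> (jacobi_list n)`_i = jacobi_moment i.
Proof.
elim: n => // n IH; rewrite ltnS leq_eqVlt => /orP[/eqP -> //|iln].
by rewrite [jacobi_list n.+1]/= nth_rcons size_jacobi_list iln IH.
Qed.

Lemma jacobi_moment0 : jacobi_moment 0 = 1. Proof. by []. Qed.

Lemma jacobi_moment1 : jacobi_moment 1 = 0. Proof. by []. Qed.

Lemma jacobi_momentSS r :
  jacobi_moment r.+2 = \sum_(p < r.+1) a p * jacobi_moment (r - p).
Proof.
rewrite /jacobi_moment -[jacobi_list r.+3]/(rcons (jacobi_list r.+2)
  (\sum_(p < r.+1) a p * (jacobi_list r.+2)`_(r - p))).
rewrite nth_rcons size_jacobi_list ltnn eqxx; apply: eq_bigr => p _.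
by rewrite nth_jacobi_list// ltnS (leq_trans (leq_subr _ _)).
Qed.

End JacobiSequence.

Section Transforms.
Variables (R : realType) (rho : probability R R) (N : R).
Hypothesis rho0 : rho [set x : R | N < `|x|] = 0%E.

Lemma cintegral_resolvent (z : R[i]) t : 0 < complex.Im z ->
  cintegral rho (resolvent z t) = ball_integral rho N (resolvent z t).
Proof.
move=> z0; have [m1 m2] := measurable_resolvent t z0.
apply: (cintegral_ball rho0) => //.
exact: bounded_measurable_resolvent (measurable_centered_ball N) z0.
Qed.

Lemma cauchy_transform_ball (z : R[i]) : 0 < complex.Im z ->
  cauchy_transform rho z = ball_integral rho N (resolvent z 1).
Proof.
move=> z0; rewrite -cintegral_resolvent// /cauchy_transform.
by congr cintegral; apply/funext => x; rewrite /resolvent mul1r.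
Qed.

Lemma g_transform_ball s S (z : R[i]) : 0 < S -> 0 < complex.Im z ->
  g_transform s S rho z = ball_integral rho N (resolvent z (s / S)).
Proof.
move=> S0 z0; rewrite -cintegral_resolvent// /g_transform.
congr cintegral; apply/funext => x; rewrite /resolvent.
have SC : S%:C != 0 :> R[i] by rewrite fmorph_eq0 gt_eqF.
have -> : S%:C * z - (s * x)%:C = S%:C * (z - (s / S * x)%:C).
  rewrite mulrBr -rmorphM; congr (_ - _%:C); field; exact: lt0r_neq0.
by rewrite invfM mulrA mulfV// mul1r.
Qed.

Lemma compact_support_le N' : N <= N' -> rho [set x : R | N' < `|x|] = 0%E.
Proof.
have mC (L : R) : measurable [set x : R | L < `|x|].
  rewrite -setC_centered_ball; apply: measurableC.
  exact: measurable_centered_ball.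
move=> NN'; apply/eqP; rewrite -measure_le0 -rho0 le_measure ?inE//.
by move=> x /=; exact: le_lt_trans.
Qed.

(** The positivity assumed of [a] in [jacobi_ge0], for the law of [t x] under [rho]. The radius is
    [t |N|] because [N] comes without a sign. *)
Lemma polyfun_scaled_moment_ge0 t (p : {poly R}) : 0 <= t ->
  (forall x, `|x| <= t * `|N| -> 0 <= p.[x]) ->
  0 <= polyfun (fun k => t ^+ k * moment rho k) p.
Proof.
move=> t0 p0; have mB := measurable_centered_ball N.
have rB := centered_ball_mass rho0.
have -> : (fun k => t ^+ k * moment rho k) =
    (fun k => \int[rho]_(x in centered_ball N) ((t * x) ^+ k)).
  apply/funext => k; rewrite (moment_ball _ rho0) -(bRintegralZ mB rB).
    by apply: eq_Rintegral => x _; rewrite exprMn.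
  have := bounded_measurableX k (bounded_measurable_scale N 1).
  by under eq_fun do rewrite mul1r.
rewrite -(bRintegral_horner mB rB); last exact: bounded_measurable_scale.
apply: Rintegral_ge0 => x xN; apply: p0; rewrite normrM ger0_norm//.
by rewrite ler_wpM2l// (le_trans xN)// ler_norm.
Qed.

End Transforms.

Unset Implicit Arguments.

Theorem theorem4p2 (R : realType) (A : algType R[i]) (star : A -> A)
  (phi psi : A -> R[i]) (X : nat -> A) (s S : R) (nu : probability R R) :
  star_algebra star ->
  is_state star phi -> is_state star psi -> tracial psi ->
  kargin_conditionA phi psi X ->
  (forall k : nat, exists Ck : R, forall w : seq nat, size w = k ->
     `|phi (wprod X w)| <= Ck%:C) ->
  cvgC (fun n => (\sum_(j < n) psi (X j ^+ 2)) / n%:R) (s ^+ 2)%:C ->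
  cvgC (fun n => (\sum_(j < n) phi (X j ^+ 2)) / n%:R) (S ^+ 2)%:C ->
  0 < s -> 0 < S ->
  compactly_supported nu ->
  (forall m : nat,
     cvgC (fun n => psi (normalized_sum psi X n ^+ m)) (moment nu m)%:C) ->
  exists mu : probability R R,
    [/\ compactly_supported mu,
        (forall z : R[i], 0 < complex.Im z ->
           cauchy_transform mu z = (z - g_transform s S nu z)^-1),
        (forall mu' : probability R R, compactly_supported mu' ->
           (forall z : R[i], 0 < complex.Im z ->
              cauchy_transform mu' z = (z - g_transform s S nu z)^-1) ->
           forall B : set R, measurable B -> mu' B = mu B) &
        (forall m : nat,
           cvgC (fun n => phi (normalized_sum phi X n ^+ m)) (moment mu m)%:C)].
Proof.
move=> _ [phi_lin phi1 _] [psi_lin _ _] psi_tr condA phi_bounded cvg_s cvg_S.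
move=> s0 S0 [M nu0] nm_cvg.
have t0 : 0 <= s / S by rewrite divr_ge0// ltW.
(* [a] lists the moments of the law of [t x] under [nu], with [t = s / S], and [mm] the moments of
   the limit. *)
pose a k := (s / S) ^+ k * moment nu k; pose mm := jacobi_moment a.
have moment0 : moment nu 0 = 1.
  rewrite (moment_ball _ nu0).
  exact: bRintegral_cst (measurable_centered_ball M) (centered_ball_mass nu0) 1.
have a0 : a 0%N = 1 by rewrite /a expr0 mul1r.
have tM0 : 0 <= s / S * `|M| by rewrite mulr_ge0.
(* [1 + t |M|] bounds the norm of the operator, hence the support of [mu]. *)
have K0 : 0 < 1 + s / S * `|M| by rewrite ltr_wpDr.
have mSS := jacobi_momentSS a.
have m_ge0 := jacobi_ge0 a0 (jacobi_moment0 a) (jacobi_moment1 a) mSS tM0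
  (fun p => polyfun_scaled_moment_ge0 nu0 t0).
have [mu [mu0 muE]] := bounded_moment_problem K0 (jacobi_moment0 a) m_ge0.
have tM : s / S * M <= 1 + s / S * `|M|.
  by rewrite (le_trans (ler_wpM2l t0 (ler_norm M)))// lerDr.
have cauchyE (z : R[i]) : 0 < complex.Im z ->
    cauchy_transform mu z = (z - g_transform s S nu z)^-1.
  move=> z0; rewrite (cauchy_transform_ball mu0)// (g_transform_ball nu0)//.
  have H := cauchy_functional_equation t0 tM mu0 nu0 (jacobi_moment0 a)
    (jacobi_moment1 a) mSS muE z0.
  have zg : z - ball_integral nu M (resolvent z (s / S)) != 0.
    by apply: contra_eq_neq H => ->; rewrite mulr0 eq_sym oner_neq0.
  by apply: (mulIf zg); rewrite H mulVf.
exists mu; split=> //.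
- by exists (1 + s / S * `|M|).
- move=> mu' [N mu'0] cauchyE' B mB.
  (* A common ball carrying both measures. *)
  pose L := Num.max (1 + s / S * `|M|) N.
  have KL : 1 + s / S * `|M| <= L by rewrite le_max lexx.
  have NL : N <= L by rewrite le_max lexx orbT.
  have muL := compact_support_le mu0 KL.
  have mu'L := compact_support_le mu'0 NL.
  apply: (probability_eq_of_moments muL mu'L) mB => k.
  apply: (moments_of_cauchy muL mu'L) => z z0.
  by rewrite -(cauchy_transform_ball muL)// -(cauchy_transform_ball mu'L)// cauchyE// cauchyE'.
- move=> m; rewrite muE.
  exact: (phi_moment_cvg phi_lin psi_lin phi1 psi_tr condA phi_bounded cvg_s cvg_S
    s0 S0 nm_cvg (jacobi_moment0 a) (jacobi_moment1 a) mSS).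
Qed.
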